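(* Assume that $\mathcal{C}$ is Hom-finite and satisfies the strong retraction property such that the pseudo-radical $\mathfrak{r}$ is nilpotent, that is, $\mathfrak{r}^N=0$ for some $N\in\mathbb{N}$. Let $X$ be an object in ${}_{\mathcal{C},A}\mathsf{Mod}$. Then $X$ is flat if and only if $\mathbb{H}_1^{[q]}(X)=0$ and $C_q(X)$ is a flat $A$-module for each $q\in\mathcal{C}$.
   Context: Let $\Bbbk$ be a commutative ring, $A$ an associative $\Bbbk$-algebra, and $\mathcal{C}$ a small $\Bbbk$-linear category such that $\mathcal{C}(p,q)$ is a projective $\Bbbk$-module for all $p,q\in\mathcal{C}$. ${}_{\mathcal{C},A}\mathsf{Mod}$ is the category of $\Bbbk$-linear functors from $\mathcal{C}$ to left $A$-modules, and $\mathsf{Mod}_{\mathcal{C},A}$ is the category of $\Bbbk$-linear functors from $\mathcal{C}^{\mathrm{op}}$ to right $A$-modules. Conditions on $\mathcal{C}$: - Hom-finite: each $\mathcal{C}(p,q)$ is a finitely generated projective $\Bbbk$-module. - Strong retraction property: for each $q$ the unit map $\Bbbk\to\mathcal{C}(q,q)$, $x\mapsto x\cdot\mathrm{id}_q$, admits a $\Bbbk$-module retraction, and there is a (fixed) collection of $\Bbbk$-submodules $\mathfrak{r}_q$ with $\mathcal{C}(q,q)=(\Bbbk\cdot\mathrm{id}_q)\oplus\mathfrak{r}_q$, $\mathfrak{r}_q\circ\mathfrak{r}_q\subseteq\mathfrak{r}_q$ for all $q$, and $\mathcal{C}(q,p)\circ\mathcal{C}(p,q)\subseteq\mathfrak{r}_q$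 for all $p\neq q$. - Pseudo-radical: the ideal $\mathfrak{r}$ of $\mathcal{C}$ with $\mathfrak{r}(q,q)=\mathfrak{r}_q$ and $\mathfrak{r}(p,q)=\mathcal{C}(p,q)$ for $p\neq q$. Tensor product: for $X\in{}_{\mathcal{C},A}\mathsf{Mod}$, the functor $-\otimes_{\mathcal{C},A}X:\mathsf{Mod}_{\mathcal{C},A}\to{}_{\Bbbk}\mathsf{Mod}$ is the left adjoint of $G\mapsto\mathrm{Hom}_{\Bbbk}(X,G)$, where $\mathrm{Hom}_{\Bbbk}(X,G)(q)=\mathrm{Hom}_{\Bbbk}(X(q),G)$. When $A=\Bbbk$ write $\otimes_{\mathcal{C}}$, with left derived functors $\mathrm{Tor}^{\mathcal{C}}_i$. $F\in{}_{\mathcal{C},A}\mathsf{Mod}$ is flat if every epimorphism $M\to F$ is pure, i.e. $\mathrm{Hom}(T,M)\to\mathrm{Hom}(T,F)$ is surjective for every finitely presented $T$; equivalently $-\otimes_{\mathcal{C},A}F$ is exact. $S\{q\}=\mathcal{C}(-,q)/\mathfrak{r}(-,q):\mathcal{C}^{\mathrm{op}}\to{}_{\Bbbk}\mathsf{Mod}$ is the stalk functor (value $\Bbbk$ at $q$ and $0$ elsewhere). For $X\in{}_{\mathcal{C},A}\mathsf{Mod}$, $\mathbb{H}_1^{[q]}(X)=\mathrm{Tor}_1^{\mathcal{C}}(S\{q\},X)$ and $C_q(X)=S\{q\}\otimes_{\mathcal{C}}X$, both $A$-modules via the action of $A$ on $X$. *)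

(* Defs.v *)
From HB Require Import structures.
From mathcomp Require Import all_boot all_algebra generic_quotient.
From mathcomp Require Import boolp.

Set Implicit Arguments.
Unset Strict Implicit.
Unset Printing Implicit Defensive.

Import GRing.Theory.
Local Open Scope quotient_scope.
Local Open Scope ring_scope.

Definition surj (T U : Type) (f : T -> U) : Prop := forall y, exists x, f x = y.

Definition exact_at (U V W : zmodType) (f : U -> V) (g : V -> W) : Prop :=
  forall y, g y = 0 <-> exists x, f x = y.

Definition projective_module (R : pzRingType) (M : lmodType R) : Prop :=
  forall (U V : lmodType R) (e : {linear U -> V}) (g : {linear M -> V}),
    surj e -> exists h : {linear M -> U}, forall x, e (h x) = g x.

Definition fin_gen_module (R : pzRingType) (M : lmodType R) : Prop :=
  exists (n : nat) (x : 'I_n -> M),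
    forall y, exists c : 'I_n -> R, y = \sum_(i < n) c i *: x i.

Record submodule (R : pzRingType) (V : lmodType R) := Submodule {
  sub_mem :> V -> Prop;
  sub0 : sub_mem 0;
  sub_lin : forall (a : R) u v, sub_mem u -> sub_mem v -> sub_mem (a *: u + v)
}.

(* A type with operations satisfying the module laws up to a congruence; its
   quotient is a module. All the modules built below are such quotients. *)
Record premodule (R : pzRingType) := PreModule {
  pm_car :> Type;
  pm0 : pm_car;
  pmN : pm_car -> pm_car;
  pmD : pm_car -> pm_car -> pm_car;
  pmZ : R -> pm_car -> pm_car;
  pm_eq : pm_car -> pm_car -> Prop;
  pm_refl : forall x, pm_eq x x;
  pm_sym : forall x y, pm_eq x y -> pm_eq y x;
  pm_trans : forall x y z, pm_eq x y -> pm_eq y z -> pm_eq x z;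
  pmN_eq : forall x y, pm_eq x y -> pm_eq (pmN x) (pmN y);
  pmD_eq : forall x y z t,
    pm_eq x y -> pm_eq z t -> pm_eq (pmD x z) (pmD y t);
  pmZ_eq : forall a x y, pm_eq x y -> pm_eq (pmZ a x) (pmZ a y);
  pmDA : forall x y z, pm_eq (pmD x (pmD y z)) (pmD (pmD x y) z);
  pmDC : forall x y, pm_eq (pmD x y) (pmD y x);
  pm0D : forall x, pm_eq (pmD pm0 x) x;
  pmND : forall x, pm_eq (pmD (pmN x) x) pm0;
  pmZA : forall a b x, pm_eq (pmZ a (pmZ b x)) (pmZ (a * b) x);
  pm1Z : forall x, pm_eq (pmZ 1 x) x;
  pmZDr : forall a x y, pm_eq (pmZ a (pmD x y)) (pmD (pmZ a x) (pmZ a y));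
  pmZDl : forall a b x, pm_eq (pmZ (a + b) x) (pmD (pmZ a x) (pmZ b x))
}.

Section PreModuleQuotient.
Variables (R : pzRingType) (P : premodule R).

Definition pm_rel : rel {classic P} := fun x y => `[< pm_eq (x : P) y >].

Lemma pm_rel_equiv : equiv_class_of pm_rel.
Proof.
split=> [x | x y | y x z].
- by apply/asboolP; apply: pm_refl.
- by apply/asboolP/asboolP => h; apply: pm_sym.
- by move=> /asboolP hxy /asboolP hyz; apply/asboolP; apply: pm_trans hyz.
Qed.

Canonical pm_equiv := EquivRelPack pm_rel_equiv.

Definition pquot : Type := {eq_quot pm_equiv}.
HB.instance Definition _ := Choice.on pquot.

Definition pq (x : P) : pquot := \pi_({eq_quot pm_equiv}) (x : {classic P}).
Definition pq_repr (u : pquot) : P := repr (u : {eq_quot pm_equiv}).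

Lemma pqP x y : pq x = pq y <-> pm_eq x y.
Proof.
split=> [h | h]; last by apply/eqmodP/asboolP.
by apply/asboolP; apply/(@eqmodP _ pm_equiv).
Qed.

Lemma pq_reprK u : pq (pq_repr u) = u.
Proof. exact: reprK. Qed.

Lemma pq_repr_eq x : pm_eq (pq_repr (pq x)) x.
Proof. by apply/pqP; rewrite pq_reprK. Qed.

Definition pq_add (u v : pquot) := pq (pmD (pq_repr u) (pq_repr v)).
Definition pq_opp (u : pquot) := pq (pmN (pq_repr u)).
Definition pq_scale (a : R) (u : pquot) := pq (pmZ a (pq_repr u)).

Lemma pq_addE x y : pq_add (pq x) (pq y) = pq (pmD x y).
Proof. by apply/pqP/pmD_eq; apply: pq_repr_eq. Qed.

Lemma pq_oppE x : pq_opp (pq x) = pq (pmN x).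
Proof. by apply/pqP/pmN_eq/pq_repr_eq. Qed.

Lemma pq_scaleE a x : pq_scale a (pq x) = pq (pmZ a x).
Proof. by apply/pqP/pmZ_eq/pq_repr_eq. Qed.

Lemma pq_ind (Q : pquot -> Prop) : (forall x, Q (pq x)) -> forall u, Q u.
Proof. by move=> h u; rewrite -(pq_reprK u). Qed.

Lemma pq_addA : associative pq_add.
Proof.
elim/pq_ind=> x; elim/pq_ind=> y; elim/pq_ind=> z.
by rewrite !pq_addE; apply/pqP/pmDA.
Qed.

Lemma pq_addC : commutative pq_add.
Proof.
by elim/pq_ind=> x; elim/pq_ind=> y; rewrite !pq_addE; apply/pqP/pmDC.
Qed.

Lemma pq_add0 : left_id (pq (pm0 P)) pq_add.
Proof. by elim/pq_ind=> x; rewrite pq_addE; apply/pqP/pm0D. Qed.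

Lemma pq_addN : left_inverse (pq (pm0 P)) pq_opp pq_add.
Proof. by elim/pq_ind=> x; rewrite pq_oppE pq_addE; apply/pqP/pmND. Qed.

HB.instance Definition _ :=
  GRing.isZmodule.Build pquot pq_addA pq_addC pq_add0 pq_addN.

Lemma pqD x y : pq x + pq y = pq (pmD x y). Proof. exact: pq_addE. Qed.
Lemma pqN x : - pq x = pq (pmN x). Proof. exact: pq_oppE. Qed.

Lemma pq_scaleA a b u : pq_scale a (pq_scale b u) = pq_scale (a * b) u.
Proof. by elim/pq_ind: u => x; rewrite !pq_scaleE; apply/pqP/pmZA. Qed.

Lemma pq_scale1 : left_id 1 pq_scale.
Proof. by elim/pq_ind=> x; rewrite pq_scaleE; apply/pqP/pm1Z. Qed.

Lemma pq_scaleDr : right_distributive pq_scale +%R.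
Proof.
move=> a; elim/pq_ind=> x; elim/pq_ind=> y.
by rewrite !(pq_scaleE, pqD); apply/pqP/pmZDr.
Qed.

Lemma pq_scaleDl u : {morph pq_scale^~ u : a b / a + b}.
Proof.
move=> a b; elim/pq_ind: u => x.
by rewrite !(pq_scaleE, pqD); apply/pqP/pmZDl.
Qed.

HB.instance Definition _ := GRing.Zmodule_isLmodule.Build R pquot
  pq_scaleA pq_scale1 pq_scaleDr pq_scaleDl.

Lemma pqZ a x : a *: pq x = pq (pmZ a x). Proof. exact: pq_scaleE. Qed.
Lemma pq0 : 0 = pq (pm0 P). Proof. by []. Qed.

End PreModuleQuotient.

Section QuotientModule.
Variables (R : pzRingType) (V : lmodType R) (N : submodule V).

Lemma subZ a v : N v -> N (a *: v).
Proof. by move=> Nv; rewrite -[_ *: v]addr0; apply: sub_lin => //; apply: sub0. Qed.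

Lemma subD u v : N u -> N v -> N (u + v).
Proof. by move=> Nu Nv; rewrite -[u]scale1r; apply: sub_lin. Qed.

Lemma subN v : N v -> N (- v).
Proof. by move=> Nv; rewrite -scaleN1r; apply: subZ. Qed.

Program Definition quot_pre : premodule R :=
  @PreModule R V 0 -%R +%R *:%R (fun x y => N (x - y))
    _ _ _ _ _ _ _ _ _ _ _ _ _ _.
Next Obligation. by rewrite subrr; apply: sub0. Qed.
Next Obligation. by rewrite -opprB; apply: subN. Qed.
Next Obligation. by rewrite -(subrKA y); apply: subD. Qed.
Next Obligation. by rewrite -opprD; apply: subN. Qed.
Next Obligation. by rewrite opprD addrACA; apply: subD. Qed.
Next Obligation. by rewrite -scalerBr; apply: subZ. Qed.
Next Obligation. by rewrite addrA subrr; apply: sub0. Qed.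
Next Obligation. by rewrite [y + x]addrC subrr; apply: sub0. Qed.
Next Obligation. by rewrite add0r subrr; apply: sub0. Qed.
Next Obligation. by rewrite addNr subrr; apply: sub0. Qed.
Next Obligation. by rewrite scalerA subrr; apply: sub0. Qed.
Next Obligation. by rewrite scale1r subrr; apply: sub0. Qed.
Next Obligation. by rewrite scalerDr subrr; apply: sub0. Qed.
Next Obligation. by rewrite scalerDl subrr; apply: sub0. Qed.

Definition quotient : lmodType R := pquot quot_pre.

End QuotientModule.

Section Homology.
Variables (R : pzRingType) (U V W : lmodType R).
Variables (f : {linear U -> V}) (g : {linear V -> W}).

Definition cycles : Type := {x : V | g x = 0}.

Program Definition homology_pre : premodule R :=
  @PreModule R cycles (exist _ 0 _) (fun x => exist _ (- sval x) _)
    (fun x y => exist _ (sval x + sval y) _)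
    (fun a x => exist _ (a *: sval x) _)
    (fun x y => exists u, sval x - sval y = f u)
    _ _ _ _ _ _ _ _ _ _ _ _ _ _.
Next Obligation. exact: linear0. Qed.
Next Obligation. by case: x => x /= gx; rewrite linearN gx oppr0. Qed.
Next Obligation.
by case: x y => [x gx] [y gy] /=; rewrite linearD gx gy addr0.
Qed.
Next Obligation. by case: x => x /= gx; rewrite linearZ /= gx scaler0. Qed.
Next Obligation. by exists 0; rewrite linear0 subrr. Qed.
Next Obligation. by exists (- H); rewrite -opprB H0 linearN. Qed.
Next Obligation. by exists (H + H0); rewrite -(subrKA (sval y)) H1 H2 linearD. Qed.
Next Obligation. by exists (- H); rewrite -opprD H0 linearN. Qed.
Next Obligation. by exists (H + H0); rewrite opprD addrACA H1 H2 linearD. Qed.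
Next Obligation. by exists (a *: H); rewrite -scalerBr H0 linearZ. Qed.
Next Obligation. by exists 0; rewrite linear0 addrA subrr. Qed.
Next Obligation. by exists 0; rewrite linear0 [sval y + _]addrC subrr. Qed.
Next Obligation. by exists 0; rewrite linear0 add0r subrr. Qed.
Next Obligation. by exists 0; rewrite addNr subrr linear0. Qed.
Next Obligation. by exists 0; rewrite linear0 scalerA subrr. Qed.
Next Obligation. by exists 0; rewrite linear0 scale1r subrr. Qed.
Next Obligation. by exists 0; rewrite linear0 scalerDr subrr. Qed.
Next Obligation. by exists 0; rewrite linear0 scalerDl subrr. Qed.

Definition homology : lmodType R := pquot homology_pre.

End Homology.

(* An associative k-algebra, as a ring with a central ring morphism from k.
   MathComp's [algType] would exclude the zero algebra. *)
Record kalgebra (k : comPzRingType) := KAlgebra {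
  alg_ring :> pzRingType;
  alg_map : {rmorphism k -> alg_ring};
  alg_central : forall c a, alg_map c * a = a * alg_map c
}.

Record klincat (k : comPzRingType) := KLinCat {
  obj :> Type;
  hom : obj -> obj -> lmodType k;
  idm : forall p, hom p p;
  comp : forall p q r, hom q r -> hom p q -> hom p r;
  comp_linl : forall p q r (f : hom p q),
    linear (fun g : hom q r => comp g f : hom p r);
  comp_linr : forall p q r (g : hom q r),
    linear (fun f : hom p q => comp g f : hom p r);
  compA : forall p q r s (h : hom r s) (g : hom q r) (f : hom p q),
    comp h (comp g f) = comp (comp h g) f;
  comp1m : forall p q (f : hom p q), comp (idm q) f = f;
  compm1 : forall p q (f : hom p q), comp f (idm p) = f
}.
Arguments hom {k C} : rename.
Arguments idm {k C} : rename.
Arguments comp {k C p q r} : rename.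

Section Opposite.
Variables (k : comPzRingType) (C : klincat k).

Definition opcat : klincat k.
Proof.
refine (@KLinCat k C (fun p q => hom q p) idm (fun p q r g f => comp f g)
  _ _ _ _ _).
- by move=> p q r f; apply: comp_linr.
- by move=> p q r g; apply: comp_linl.
- by move=> p q r s h g f; rewrite compA.
- by move=> p q f; apply: compm1.
- by move=> p q f; apply: comp1m.
Defined.

End Opposite.

(* k-linear functors from C to left R-modules, where k acts on R-modules through
   eta; taking eta the identity of k gives functors to k-modules. *)
Record klfun (k : comPzRingType) (C : klincat k) (R : pzRingType)
    (eta : k -> R) := KLFun {
  fobj :> C -> lmodType R;
  fact : forall p q, hom p q -> {linear fobj p -> fobj q};
  fact_lin : forall p q (a : k) (f g : hom p q) x,
    fact (a *: f + g) x = eta a *: fact f x + fact g x;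
  fact_id : forall p x, fact (idm p) x = x;
  fact_comp : forall p q r (g : hom q r) (f : hom p q) x,
    fact (comp g f) x = fact g (fact f x)
}.
Arguments fact {k C R eta} _ {p q}.

Definition lMod (k : comPzRingType) (C : klincat k) (A : kalgebra k) :=
  klfun C (alg_map A).

Definition rMod (k : comPzRingType) (C : klincat k) :=
  klfun (opcat C) (@idfun k).

Section FunctorCategory.
Variables (k : comPzRingType) (C : klincat k) (R : pzRingType) (eta : k -> R).
Implicit Types F G H M P T Z : klfun C eta.

Record fmor F G := FMor {
  fcomp :> forall p, {linear F p -> G p};
  fcomp_nat : forall p q (f : hom p q) x,
    fcomp q (fact F f x) = fact G f (fcomp p x)
}.

Definition epi F G (e : fmor F G) : Prop :=
  forall Z (u v : fmor G Z),
    (forall p x, u p (e p x) = v p (e p x)) -> forall p y, u p y = v p y.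

Definition projective_fun P : Prop :=
  forall M N (e : fmor M N) (g : fmor P N), epi e ->
    exists h : fmor P M, forall p x, e p (h p x) = g p x.

(* Formal R-linear combinations of [f . x_i] with f : q_i -> p, that is,
   representatives of the elements at p of the free functor on generators
   x_i placed at the objects q_i *)
Definition formal n (q : 'I_n -> C) (p : C) :=
  seq (R * {i : 'I_n & hom (q i) p}).

Definition eval_formal n (q : 'I_n -> C) p Z (z : forall i, Z (q i))
    (s : formal q p) : Z p :=
  \sum_(t <- s) t.1 *: fact Z (tagged t.2) (z (tag t.2)).

(* Finitely many generators and relations: T represents the functor sending Z
   to the families z satisfying the relations; equivalently T is the cokernel
   of a morphism between finite direct sums of representables. *)
Definition fin_presented T : Prop :=
  exists (n : nat) (q : 'I_n -> C) (m : nat) (p : 'I_m -> C)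
         (r : forall j, formal q (p j)) (x : forall i, T (q i)),
    (forall j, eval_formal x (r j) = 0) /\
    forall Z (z : forall i, Z (q i)), (forall j, eval_formal z (r j) = 0) ->
      (exists u : fmor T Z, forall i, u (q i) (x i) = z i) /\
      (forall u v : fmor T Z, (forall i, u (q i) (x i) = v (q i) (x i)) ->
         forall s y, u s y = v s y).

Definition pure_epi M F (e : fmor M F) : Prop :=
  forall T, fin_presented T -> forall g : fmor T F,
    exists h : fmor T M, forall p x, e p (h p x) = g p x.

Definition flat_fun F : Prop :=
  forall M (e : fmor M F), epi e -> pure_epi e.

End FunctorCategory.

(* The module generated by t : T, subject to the relations valid for every
   family phi : T -> V (V a k-module) satisfying td_ok *)
Record tensor_data (k : comPzRingType) (R : pzRingType) := TensorData {
  td_gen :> Type;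
  td_ok : forall V : lmodType k, (td_gen -> V) -> Prop;
  td_scale : R -> td_gen -> td_gen;
  td_okZ : forall (V : lmodType k) (phi : td_gen -> V) a,
    td_ok phi -> td_ok (phi \o td_scale a);
  td_scale1 : forall (V : lmodType k) (phi : td_gen -> V), td_ok phi ->
    forall t, phi (td_scale 1 t) = phi t;
  td_scaleM : forall (V : lmodType k) (phi : td_gen -> V), td_ok phi ->
    forall a b t, phi (td_scale (a * b) t) = phi (td_scale a (td_scale b t));
  td_scaleD : forall (V : lmodType k) (phi : td_gen -> V), td_ok phi ->
    forall a b t,
      phi (td_scale (a + b) t) = phi (td_scale a t) + phi (td_scale b t)
}.

Section UniversalModule.
Variables (k : comPzRingType) (R : pzRingType) (T : tensor_data k R).
Implicit Types s t : seq T.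

Definition td_sum (V : lmodType k) (phi : T -> V) s : V := \sum_(x <- s) phi x.

Definition td_eq s t : Prop :=
  forall (V : lmodType k) (phi : T -> V), td_ok phi ->
    td_sum phi s = td_sum phi t.

Lemma td_scaleN (V : lmodType k) (phi : T -> V) : td_ok phi ->
  forall x, phi (td_scale (-1) x) = - phi x.
Proof.
move=> hphi x; apply: (addIr (phi (td_scale 1 x))).
rewrite -td_scaleD // addNr td_scale1 // addNr.
by apply: (addIr (phi (td_scale 0 x))); rewrite -td_scaleD // !add0r.
Qed.

Lemma td_sum_map (V : lmodType k) (phi : T -> V) (h : T -> T) s :
  td_sum phi (map h s) = td_sum (phi \o h) s.
Proof. by rewrite /td_sum big_map. Qed.

Lemma td_sum_cat (V : lmodType k) (phi : T -> V) s t :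
  td_sum phi (s ++ t) = td_sum phi s + td_sum phi t.
Proof. by rewrite /td_sum big_cat. Qed.

Lemma td_sumN (V : lmodType k) (phi : T -> V) s : td_ok phi ->
  td_sum phi (map (td_scale (-1)) s) = - td_sum phi s.
Proof.
move=> hphi; rewrite td_sum_map /td_sum -sumrN.
by apply: eq_bigr => x _ /=; rewrite td_scaleN.
Qed.

Program Definition td_pre : premodule R :=
  @PreModule R (seq T) [::] (map (td_scale (-1))) cat
    (fun a => map (td_scale a)) td_eq _ _ _ _ _ _ _ _ _ _ _ _ _ _.
Next Obligation. by []. Qed.
Next Obligation. by move=> V phi hphi; rewrite H. Qed.
Next Obligation. by move=> V phi hphi; rewrite H // H0. Qed.
Next Obligation. by move=> V phi hphi; rewrite !td_sumN // H. Qed.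
Next Obligation. by move=> V phi hphi; rewrite !td_sum_cat H // H0. Qed.
Next Obligation.
by move=> V phi hphi; rewrite !td_sum_map; apply: H; apply: td_okZ.
Qed.
Next Obligation. by move=> V phi hphi; rewrite catA. Qed.
Next Obligation. by move=> V phi hphi; rewrite !td_sum_cat addrC. Qed.
Next Obligation. by []. Qed.
Next Obligation.
by move=> V phi hphi; rewrite td_sum_cat td_sumN // addNr /td_sum big_nil.
Qed.
Next Obligation.
move=> V phi hphi; rewrite !td_sum_map /td_sum; apply: eq_bigr => x' _ /=.
by rewrite td_scaleM.
Qed.
Next Obligation.
move=> V phi hphi; rewrite !td_sum_map /td_sum; apply: eq_bigr => x' _ /=.
by rewrite td_scale1.
Qed.
Next Obligation. by rewrite map_cat. Qed.
Next Obligation.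
move=> V phi hphi; rewrite td_sum_cat !td_sum_map /td_sum -big_split /=.
by apply: eq_bigr => x' _ /=; rewrite td_scaleD.
Qed.

Definition td_mod : lmodType R := pquot td_pre.

Definition td_in (x : T) : td_mod := pq (P := td_pre) [:: x].

Definition td_lift (V : lmodType k) (phi : T -> V) (u : td_mod) : V :=
  td_sum phi (pq_repr u).

Lemma td_liftE (V : lmodType k) (phi : T -> V) s : td_ok phi ->
  td_lift phi (pq (P := td_pre) s) = td_sum phi s.
Proof. by move=> hphi; apply: (pq_repr_eq (P := td_pre)). Qed.

Lemma td_lift_in (V : lmodType k) (phi : T -> V) x : td_ok phi ->
  td_lift phi (td_in x) = phi x.
Proof. by move=> hphi; rewrite td_liftE // /td_sum big_seq1. Qed.

Lemma td_liftD (V : lmodType k) (phi : T -> V) : td_ok phi ->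
  {morph td_lift phi : u v / u + v}.
Proof.
move=> hphi; elim/pq_ind=> s; elim/pq_ind=> t.
by rewrite pqD !td_liftE //= td_sum_cat.
Qed.

Lemma td_spanE s : pq (P := td_pre) s = \sum_(x <- s) td_in x.
Proof.
elim: s => [|x s IHs]; first by rewrite big_nil.
by rewrite big_cons -IHs pqD.
Qed.

Lemma td_in_scale a x : td_in (td_scale a x) = a *: td_in x.
Proof. by rewrite pqZ. Qed.

End UniversalModule.

Section TensorMap.
Variables (k : comPzRingType) (R : pzRingType) (T T' : tensor_data k R).
Variable h : T -> T'.
Hypothesis h_ok : forall (V : lmodType k) (phi : T' -> V),
  td_ok phi -> td_ok (phi \o h).
Hypothesis h_scale : forall a x, h (td_scale a x) = td_scale a (h x).

Definition td_map (u : td_mod T) : td_mod T' :=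
  pq (P := td_pre T') (map h (pq_repr u)).

Lemma td_mapE s : td_map (pq (P := td_pre T) s) = pq (P := td_pre T') (map h s).
Proof.
apply/pqP => V phi hphi; rewrite /td_sum !big_map.
by apply: (pq_repr_eq (P := td_pre T)); apply: h_ok.
Qed.

Lemma td_map_linear : linear td_map.
Proof.
move=> a; elim/pq_ind=> s; elim/pq_ind=> t.
rewrite pqZ pqD !td_mapE pqZ pqD /= map_cat -map_comp.
by rewrite (eq_map (h_scale a)) map_comp.
Qed.

End TensorMap.

Section TensorOverC.
Variables (k : comPzRingType) (C : klincat k) (A : kalgebra k).

(* phi is a natural transformation from G to p |-> Hom_k(X p, V). *)
Record balanced (G : rMod C) (X : lMod C A) (V : lmodType k)
    (phi : forall p : C, G p -> X p -> V) : Prop := Balanced {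
  bal_linl : forall p (a : k) g g' x,
    phi p (a *: g + g') x = a *: phi p g x + phi p g' x;
  bal_linr : forall p (a : k) g x x',
    phi p g (alg_map A a *: x + x') = a *: phi p g x + phi p g x';
  bal_act : forall (p q : C) (f : hom p q) (g : G q) x,
    phi p (fact G (f : @hom _ (opcat C) q p) g) x = phi q g (fact X f x)
}.

Section Object.
Variables (G : rMod C) (X : lMod C A).

Definition tens_gen : Type := {p : C & (G p * X p)%type}.

Definition tens_ok (V : lmodType k) (phi : tens_gen -> V) : Prop :=
  balanced (fun p g x => phi (existT _ p (g, x))).

Program Definition tens_data : tensor_data k A :=
  @TensorData k A tens_gen tens_ok
    (fun a t => existT _ (tag t) ((tagged t).1, a *: (tagged t).2)) _ _ _ _.
Next Obligation.
case: H => hl hr hb; split=> /= [p c g g' x | p c g x x' | p q f g x].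
- by rewrite hl.
- by rewrite -hr scalerDr !scalerA alg_central.
- by rewrite hb linearZ.
Qed.
Next Obligation. by case: t => p [g x] /=; rewrite scale1r. Qed.
Next Obligation. by case: t => p [g x] /=; rewrite scalerA. Qed.
Next Obligation.
case: t => p [g x] /=; case: H => _ hr _.
by have := hr p 1 g (a *: x) (b *: x); rewrite rmorph1 !scale1r scalerDl.
Qed.

(* The tensor product of G and X over C, with A acting through X; its
   underlying k-module is the coend of G p (x)_k X p. *)
Definition tens : lmodType A := td_mod tens_data.

Definition tens_pure (p : C) (g : G p) (x : X p) : tens :=
  td_in (T := tens_data) (existT _ p (g, x)).

Lemma tens_pureZ a p (g : G p) (x : X p) :
  tens_pure g (a *: x) = a *: tens_pure g x.
Proof. by rewrite -td_in_scale. Qed.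

Lemma tens_pure_linl p (a : k) (g g' : G p) (x : X p) :
  tens_pure (a *: g + g') x = alg_map A a *: tens_pure g x + tens_pure g' x.
Proof.
rewrite -tens_pureZ pqD; apply/pqP => V phi hphi.
rewrite /td_sum !big_cons !big_nil !addr0; case: (hphi) => hl hr hb.
have := hr p a g x 0; have := hr p a g 0 0.
rewrite hl.
have h0 : phi (existT _ p (g, 0)) = 0.
  have := hr p 1 g 0 0; rewrite rmorph1 !scale1r addr0 => h.
  by apply: (addrI (phi (existT _ p (g, 0)))); rewrite -h addr0.
by rewrite h0 !addr0 => _ ->.
Qed.

Lemma tens_pureD p (g : G p) (x x' : X p) :
  tens_pure g (x + x') = tens_pure g x + tens_pure g x'.
Proof.
rewrite pqD; apply/pqP => V phi [_ hr _].
rewrite /td_sum !big_cons !big_nil !addr0.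
by have := hr p 1 g x x'; rewrite rmorph1 !scale1r.
Qed.

Lemma tens_pure_act (p q : C) (f : hom p q) (g : G q) (x : X p) :
  tens_pure (fact G (f : @hom _ (opcat C) q p) g) x = tens_pure g (fact X f x).
Proof.
by apply/pqP => V phi [_ _ hb]; rewrite /td_sum !big_cons !big_nil !addr0.
Qed.

(* (- (x)_C X) is left adjoint to Hom_k(X, -). *)
Lemma tens_adjunction (V : lmodType k) (phi : forall p : C, G p -> X p -> V) :
  balanced phi ->
  exists2 h : tens -> V,
    [/\ {morph h : u v / u + v},
        forall (c : k) u, h (alg_map A c *: u) = c *: h u
      & forall p g x, h (@tens_pure p g x) = phi p g x]
    & forall h' : tens -> V, {morph h' : u v / u + v} ->
        (forall p g x, h' (@tens_pure p g x) = phi p g x) -> h' =1 h.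
Proof.
move=> hphi; pose psi (t : tens_data) : V := phi (tag t) (tagged t).1 (tagged t).2.
have hpsi : @td_ok _ _ tens_data V psi by [].
exists (td_lift psi); first split.
- exact: td_liftD.
- move=> c; elim/pq_ind=> s; rewrite pqZ !td_liftE // td_sum_map /td_sum.
  rewrite scaler_sumr; apply: eq_bigr => -[p [g x]] _ /=; rewrite /psi /=.
  case: hphi => _ hr _.
  have h0 : phi p g 0 = 0.
    have := hr p 1 g 0 0; rewrite rmorph1 !scale1r addr0 => h.
    by apply: (addrI (phi p g 0)); rewrite -h addr0.
  by have := hr p c g x 0; rewrite h0 !addr0.
- by move=> p g x; rewrite td_lift_in.
move=> h' h'D h'E; elim/pq_ind=> s; rewrite td_liftE // td_spanE.
have h'0 : h' 0 = 0 by apply: (addrI (h' 0)); rewrite -h'D !addr0.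
elim: s => [|[p [g x]] s IHs]; first by rewrite /td_sum !big_nil.
by rewrite /td_sum !big_cons h'D IHs; congr (_ + _); apply: h'E.
Qed.

End Object.

Section Morphism.
Variables (G G' : rMod C) (X : lMod C A) (d : fmor G G').

Definition tens_gen_map (t : tens_data G X) : tens_data G' X :=
  existT _ (tag t) (d (tag t) (tagged t).1, (tagged t).2).

Lemma tens_gen_map_ok (V : lmodType k) (phi : tens_data G' X -> V) :
  td_ok phi -> td_ok (phi \o tens_gen_map).
Proof.
case=> hl hr hb; split=> /= [p c g g' x | p c g x x' | p q f g x].
- by rewrite /tens_gen_map /= linearP hl.
- exact: hr.
- by rewrite /tens_gen_map /= fcomp_nat hb.
Qed.

Definition tens_map_fun : tens G X -> tens G' X := td_map tens_gen_map.

Lemma tens_map_linear : linear tens_map_fun.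
Proof. by apply: td_map_linear => //; apply: tens_gen_map_ok. Qed.

HB.instance Definition _ := GRing.isLinear.Build A (tens G X) (tens G' X) *:%R
  tens_map_fun tens_map_linear.

Definition tens_map : {linear tens G X -> tens G' X} := tens_map_fun.

Lemma tens_mapE p (g : G p) (x : X p) :
  tens_map (tens_pure g x) = tens_pure (d p g) x.
Proof. by rewrite /tens_map /= /tens_map_fun td_mapE //; apply: tens_gen_map_ok. Qed.

End Morphism.

End TensorOverC.
Arguments tens_map {k C A G G'} X d.

Record projective_resolution (k : comPzRingType) (C : klincat k) (G : rMod C) :=
  ProjectiveResolution {
  res :> nat -> rMod C;
  res_proj : forall n, projective_fun (res n);
  res_d : forall n, fmor (res n.+1) (res n);
  res_aug : fmor (res 0) G;
  res_aug_surj : forall p, surj (res_aug p);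
  res_exact0 : forall p, exact_at (res_d 0 p) (res_aug p);
  res_exact : forall n p, exact_at (res_d n.+1 p) (res_d n p)
}.

(* The i-th left derived functor of (- (x)_C X) at G *)
Definition Tor (k : comPzRingType) (C : klincat k) (A : kalgebra k)
    (G : rMod C) (P : projective_resolution G) (i : nat) (X : lMod C A) :
    lmodType A :=
  match i with
  | 0 => homology (tens_map X (res_d P 0)) (\0 : {linear tens (P 0) X -> tens (P 0) X})
  | j.+1 => homology (tens_map X (res_d P j.+1)) (tens_map X (res_d P j))
  end.

Section TensorOverA.
Variables (k : comPzRingType) (A : kalgebra k).

(* A right A-module is a module over the converse ring A^c, so that
   (a : A^c) *: m is the product of m by a on the right. *)
Record abalanced (M : lmodType A^c) (N : lmodType A) (V : lmodType k)
    (phi : M -> N -> V) : Prop := ABalanced {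
  abal_Dl : forall m m' n, phi (m + m') n = phi m n + phi m' n;
  abal_Dr : forall m n n', phi m (n + n') = phi m n + phi m n';
  abal_act : forall (a : A) m n, phi ((a : A^c) *: m) n = phi m (a *: n);
  abal_Z : forall (c : k) m n, phi m (alg_map A c *: n) = c *: phi m n
}.

Section Object.
Variables (M : lmodType A^c) (N : lmodType A).

Definition atens_ok (V : lmodType k) (phi : M * N -> V) : Prop :=
  abalanced (fun m n => phi (m, n)).

Program Definition atens_data : tensor_data k k :=
  @TensorData k k (M * N)%type atens_ok
    (fun c t => (t.1, alg_map A c *: t.2)) _ _ _ _.
Next Obligation.
case: H => hl hr hb hz; split=> /= [m m' n | m n n' | b m n | c m n].
- by rewrite hl.
- by rewrite scalerDr hr.
- by rewrite hb !scalerA alg_central.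
- by rewrite !hz !scalerA mulrC.
Qed.
Next Obligation. by rewrite rmorph1 scale1r. Qed.
Next Obligation. by rewrite rmorphM scalerA. Qed.
Next Obligation. by case: H => _ hr _ _; rewrite rmorphD scalerDl hr. Qed.

Definition atens : lmodType k := td_mod atens_data.

Definition atens_pure (m : M) (n : N) : atens := td_in (T := atens_data) (m, n).

End Object.

Section Morphism.
Variables (M M' : lmodType A^c) (N : lmodType A) (d : {linear M -> M'}).

Definition atens_gen_map (t : atens_data M N) : atens_data M' N := (d t.1, t.2).

Lemma atens_gen_map_ok (V : lmodType k) (phi : atens_data M' N -> V) :
  td_ok phi -> td_ok (phi \o atens_gen_map).
Proof.
case=> hl hr hb hz; split=> /= [m m' n | m n n' | b m n | c m n].
- by rewrite /atens_gen_map /= raddfD hl.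
- exact: hr.
- by rewrite /atens_gen_map /= linearZ hb.
- exact: hz.
Qed.

Definition atens_map_fun : atens M N -> atens M' N := td_map atens_gen_map.

Lemma atens_map_linear : linear atens_map_fun.
Proof. by apply: td_map_linear => //; apply: atens_gen_map_ok. Qed.

HB.instance Definition _ := GRing.isLinear.Build k (atens M N) (atens M' N) *:%R
  atens_map_fun atens_map_linear.

Definition atens_map : {linear atens M N -> atens M' N} := atens_map_fun.

End Morphism.

Definition flat_module (N : lmodType A) : Prop :=
  forall (L M P : lmodType A^c) (f : {linear L -> M}) (g : {linear M -> P}),
    exact_at f g -> exact_at (atens_map N f) (atens_map N g).

End TensorOverA.

Section Conditions.
Variables (k : comPzRingType) (C : klincat k).

Definition homs_projective : Prop :=
  forall p q : C, projective_module (hom p q).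

Definition Hom_finite : Prop :=
  forall p q : C, fin_gen_module (hom p q) /\ projective_module (hom p q).

Record strong_retraction := StrongRetraction {
  unit_retraction : forall q : C,
    exists rho : {linear hom q q -> k^o}, forall c : k, rho (c *: idm q) = c;
  rad : forall q : C, submodule (hom q q);
  rad_sum : forall (q : C) (f : hom q q),
    exists (c : k) (g : hom q q), rad q g /\ f = c *: idm q + g;
  rad_direct : forall (q : C) (c : k), rad q (c *: idm q) -> c *: idm q = 0;
  rad_comp : forall (q : C) (g f : hom q q),
    rad q g -> rad q f -> rad q (comp g f);
  rad_offdiag : forall (p q : C) (g : hom p q) (f : hom q p),
    p <> q -> rad q (comp g f)
}.

Definition cat_ideal := forall p q : C, hom p q -> Prop.

Inductive ideal_mul (I J : cat_ideal) (p q : C) : hom p q -> Prop :=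
| ideal_mul0 : ideal_mul I J (0 : hom p q)
| ideal_mul_comp s (g : hom s q) (f : hom p s) :
    I s q g -> J p s f -> ideal_mul I J (comp g f)
| ideal_mul_lin (a : k) (u v : hom p q) :
    ideal_mul I J u -> ideal_mul I J v -> ideal_mul I J (a *: u + v).

Fixpoint ideal_exp (I : cat_ideal) (n : nat) : cat_ideal :=
  match n with
  | 0 => fun _ _ _ => True
  | 1 => I
  | m.+1 => fun p q f => ideal_mul I (ideal_exp I m) f
  end.

Definition nilpotent_ideal (I : cat_ideal) : Prop :=
  exists N, forall (p q : C) (f : hom p q), ideal_exp I N f -> f = 0.

Variable S : strong_retraction.

Inductive pseudo_radical : cat_ideal :=
| psrad_diag q f : rad S q f -> @pseudo_radical q q f
| psrad_off p q (f : hom p q) : p <> q -> pseudo_radical f.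

Lemma psrad_diagP q (f : hom q q) : pseudo_radical f -> rad S q f.
Proof.
pose Q p r (g : hom p r) := forall e : r = p, rad S p (ecast t (hom p t) e g).
have gen p r (g : hom p r) : pseudo_radical g -> Q p r g.
  case=> [s h hh e | s t h ne e]; first by rewrite (Prop_irrelevance e erefl).
  by case: ne.
by move/gen/(_ erefl).
Qed.

Lemma psrad0 p q : @pseudo_radical p q 0.
Proof.
have [e | ne] := EM (p = q); last exact: psrad_off.
by case: q / e; apply/psrad_diag/sub0.
Qed.

Lemma psrad_lin p q (a : k) (u v : hom p q) :
  pseudo_radical u -> pseudo_radical v -> pseudo_radical (a *: u + v).
Proof.
have [e | ne] := EM (p = q); last by move=> _ _; apply: psrad_off.
case: q / e u v => u v /psrad_diagP hu /psrad_diagP hv.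
exact/psrad_diag/sub_lin.
Qed.

Definition pseudo_radical_sub p q : submodule (@hom _ C p q) :=
  @Submodule _ _ (@pseudo_radical p q) (@psrad0 p q) (@psrad_lin p q).

Lemma psrad_compr p q r (g : hom q r) (f : hom p q) :
  pseudo_radical g -> pseudo_radical (comp g f).
Proof.
have [e | ne] := EM (p = r); last by move=> _; apply: psrad_off.
case: r / e g => g hg; apply: psrad_diag.
have [e | ne] := EM (p = q); last by apply: rad_offdiag => /esym.
case: q / e f g hg => f g /psrad_diagP hg.
have [c [f' [hf' ->]]] := rad_sum S f.
have -> : comp g (c *: idm p + f') = c *: comp g (idm p) + comp g f'.
  exact: (comp_linr g).
by rewrite compm1; apply: sub_lin => //; apply: rad_comp.
Qed.

Variable q : C.

Definition stalk_act_fun (s p : C) (f : hom p s) (u : quotient (pseudo_radical_sub s q)) :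
    quotient (pseudo_radical_sub p q) :=
  pq (P := quot_pre (pseudo_radical_sub p q)) (comp (pq_repr u : hom s q) f).

Lemma stalk_actE (s p : C) (f : hom p s) (g : hom s q) :
  stalk_act_fun f (pq (P := quot_pre (pseudo_radical_sub s q)) g) =
  pq (P := quot_pre (pseudo_radical_sub p q)) (comp g f).
Proof.
apply/pqP => /=; set g' := pq_repr _.
have -> : comp (g' : hom s q) f - comp g f = comp (g' - g) f.
  rewrite -scaleN1r addrC -(comp_linl f) /=; congr comp.
  by rewrite scaleN1r addrC.
apply: psrad_compr; exact: (pq_repr_eq (P := quot_pre (pseudo_radical_sub s q)) g).
Qed.

Lemma stalk_act_linear (s p : C) (f : hom p s) : linear (stalk_act_fun f).
Proof.
move=> a; elim/pq_ind=> g; elim/pq_ind=> h.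
rewrite pqZ pqD !stalk_actE pqZ pqD /=; congr pq; exact: (comp_linl f).
Qed.

HB.instance Definition _ (s p : C) (f : hom p s) :=
  GRing.isLinear.Build k _ _ *:%R (stalk_act_fun f) (stalk_act_linear f).

(* The stalk functor S{q} = C(-, q) / r(-, q) *)
Program Definition stalk : rMod C :=
  @KLFun k (opcat C) k (@idfun k) (fun p => quotient (pseudo_radical_sub p q))
    (fun s p (f : @hom _ C p s) =>
       (stalk_act_fun f : {linear quotient (pseudo_radical_sub s q) -> quotient (pseudo_radical_sub p q)}))
    _ _ _.
Next Obligation.
elim/pq_ind: x => h; rewrite !stalk_actE pqZ pqD /=.
by congr pq; exact: (comp_linr h).
Qed.
Next Obligation. by elim/pq_ind: x => h; rewrite stalk_actE compm1. Qed.
Next Obligation. by elim/pq_ind: x => h; rewrite !stalk_actE compA. Qed.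

End Conditions.

Section HomologicalFunctors.
Variables (k : comPzRingType) (C : klincat k) (A : kalgebra k).
Variables (S : strong_retraction C) (q : C) (X : lMod C A).

Definition C_functor : lmodType A := tens (stalk S q) X.

Definition H1 (P : projective_resolution (stalk S q)) : lmodType A := Tor P 1 X.

(* Tor does not depend on the resolution up to isomorphism, and resolutions
   exist, so quantifying over all of them only avoids choosing one. *)
Definition H1_vanishes : Prop :=
  forall (P : projective_resolution (stalk S q)) (h : H1 P), h = 0.

End HomologicalFunctors.

(* Main.v *)
From HB Require Import structures.
From mathcomp Require Import all_boot all_algebra.
From mathcomp Require Import boolp.
Require Import Defs.

(** Fix a free functor F with a pointwise surjective morphism e : F -> X.
Call a morphism psi : F -> F with e psi = e a correction of e, and write K
for the kernel of e.  Corrections compose, and each of them maps K to K.  The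
whole argument is about the property

  (V)  each element of K is annihilated by some correction.

It is the form of flatness that Villamayor gave for modules, and it is
equivalent to the flatness of X.  If X is flat and m lies in K, then m only
involves finitely many generators, the quotient of a finite free functor by m
is finitely presented, and a lift of the map that it induces to X gives the
correction ([flat_killed]).  Conversely, under (V) the relations of a finitely
presented functor over X can be annihilated one after the other, so that its
generators lift to elements of F that satisfy the relations ([killed_flat]).
The same equivalence holds for A-modules, with the exactness of the tensor
product in place of purity ([kernel_killed_flat], [flat_kernel_killed]).

From (V) to the homological conditions.  Under (V), each element of the kernel
of G (x) F -> G (x) X is annihilated by a correction ([tens_kernel_killed]),
for any right functor G.  For the stalk G = S{q} this is the module form of
(V) for the surjection C_q(F) -> C_q(X), and C_q(F) is locally projective, so
C_q(X) is flat ([killed_C_functor_flat]).  A 1-cycle of P (x) X, for P a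
resolution of the stalk, lifts to a 1-chain of P (x) F, whose boundary is
annihilated by a correction; the corrected chain is a cycle of P (x) F.  Now
P (x) F is a sum of copies of P(q_i) (x) A, and it is exact because P splits
at each object over k ([resolution_tens_free_exact]); so the original cycle is
a boundary ([killed_H1_vanishes]).

From the homological conditions to (V).  Let r be the pseudo-radical.  The
vanishing of H_1 at q says that an element of K(q) that lies in (r F)(q)
already lies in (r K)(q) ([H1_kernel_radical]).  The flatness of C_q(X) gives,
for m in K(q), an endomorphism of C_q(F) over C_q(X) that annihilates the stalk_class
of m; since F is free it is induced by a correction, which therefore sends m
into (r F)(q) ([flat_stalk_kills]), hence into (r K)(q).  Thus any element of
K is moved into r K by a correction, and iterating this moves it into r^n K for
every n ([kernel_into_radical_power]).  As r is nilpotent, (V) follows. *)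

Set Implicit Arguments.
Unset Strict Implicit.
Unset Printing Implicit Defensive.

Import GRing.Theory.
Local Open Scope ring_scope.

(** * Linear maps, quotients, kernels and change of rings *)

Lemma dep_choice (I : Type) (T : I -> Type) (P : forall i, T i -> Prop) :
  (forall i, exists y, P i y) -> exists f : forall i, T i, forall i, P i (f i).
Proof. by move=> h; exists (fun i => sval (cid (h i))) => i; apply: (svalP (cid (h i))). Qed.

Lemma dep_section (I : Type) (T U : I -> Type) (f : forall i, T i -> U i) :
  (forall i, surj (f i)) -> exists s : forall i, U i -> T i, forall i y, f i (s i y) = y.
Proof.
by move=> fs; exists (fun i y => sval (cid (fs i y))) => i y; apply: (svalP (cid (fs i y))).
Qed.

Section Restriction.
Variables (k : comPzRingType) (A : kalgebra k) (N : lmodType A).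

(** A copy of the carrier of [N], so that the k-module structure coming from
[alg_map] does not compete with the A-module structure. *)
Definition restr_car : Type := N.
HB.instance Definition _ := GRing.Zmodule.copy restr_car N.

Definition restr_scale (c : k) (x : restr_car) : restr_car :=
  alg_map A c *: (x : N).

Lemma restr_scaleA a b x : restr_scale a (restr_scale b x) = restr_scale (a * b) x.
Proof. by rewrite /restr_scale scalerA rmorphM. Qed.
Lemma restr_scale1 : left_id 1 restr_scale.
Proof. by move=> x; rewrite /restr_scale rmorph1 scale1r. Qed.
Lemma restr_scaleDr : right_distributive restr_scale +%R.
Proof. by move=> a x y; apply: scalerDr. Qed.
Lemma restr_scaleDl x : {morph restr_scale^~ x : a b / a + b}.
Proof. by move=> a b; rewrite /restr_scale rmorphD scalerDl. Qed.

HB.instance Definition _ := GRing.Zmodule_isLmodule.Build k restr_car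
  restr_scaleA restr_scale1 restr_scaleDr restr_scaleDl.

Definition restr : lmodType k := restr_car.

End Restriction.

Lemma restr_scaleC (k : comPzRingType) (A : kalgebra k) (N : lmodType A)
    (c : k) (a : A) (y : restr N) :
  a *: (c *: y : N) = c *: (a *: (y : N) : restr N) :> N.
Proof.
transitivity ((a * alg_map A c) *: (y : N)); first by rewrite -(@scalerA A N).
by rewrite -alg_central -(@scalerA A N).
Qed.


Section Algebras.
Variables (k : comPzRingType) (A : kalgebra k).

(** Right functors to k-modules become left functors on the opposite category
over this algebra, so that what is proved for [lMod] applies to [rMod]. *)
Definition self_alg : kalgebra k :=
  @KAlgebra k k (idfun : {rmorphism k -> k}) (fun c a => mulrC c a).

Definition opp_map (c : k) : A^c := alg_map A c.
Lemma opp_map_additive : nmod_morphism opp_map.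
Proof. split; [exact: (rmorph0 (alg_map A)) | exact: (rmorphD (alg_map A))]. Qed.
Lemma opp_map_mul : monoid_morphism opp_map.
Proof.
split; first exact: (rmorph1 (alg_map A)).
move=> a b; rewrite /opp_map mulrC; exact: (rmorphM (alg_map A)).
Qed.
HB.instance Definition _ := GRing.isNmodMorphism.Build k A^c opp_map opp_map_additive.
HB.instance Definition _ := GRing.isMonoidMorphism.Build k A^c opp_map opp_map_mul.
(** Right A-modules are modules over this algebra; it lets [restr] turn them
into k-modules as well. *)
Definition opp_alg : kalgebra k :=
  @KAlgebra k A^c (opp_map : {rmorphism k -> A^c}) (fun c a => esym (alg_central c a)).
End Algebras.

Section LinearMaps.
Variable R : pzRingType.

Definition mklin (U V : lmodType R) (f : U -> V) (hf : linear f) :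
    {linear U -> V} :=
  HB.pack f (GRing.isLinear.Build R U V *:%R f hf).

Lemma mklinE (U V : lmodType R) (f : U -> V) (hf : linear f) x :
  mklin hf x = f x.
Proof. by []. Qed.

(** Linear maps are often only given by a relation, such as the value at an
arbitrary lift; the relation is enough when it is total, functional and
compatible with linear combinations. *)
Lemma choose_linear (U V : lmodType R) (rel : U -> V -> Prop) :
  (forall x, exists y, rel x y) ->
  (forall x y y', rel x y -> rel x y' -> y = y') ->
  (forall a x x' y y', rel x y -> rel x' y' -> rel (a *: x + x') (a *: y + y')) ->
  exists f : {linear U -> V}, forall x, rel x (f x).
Proof.
move=> /choice [f hf] uniq lin.
have flin : linear f by move=> a x y; apply: uniq (hf _) _; apply: lin.
by exists (mklin flin).
Qed.

Lemma quot_eq (V : lmodType R) (N : submodule V) x y :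
  pq (P := quot_pre N) x = pq (P := quot_pre N) y <-> N (x - y).
Proof. exact: pqP. Qed.

Definition proj_fun (V : lmodType R) (N : submodule V) (x : V) : quotient N :=
  pq (P := quot_pre N) x.
Lemma proj_linear (V : lmodType R) (N : submodule V) : linear (proj_fun N).
Proof. by move=> a x y; rewrite /proj_fun pqZ pqD. Qed.
Definition proj (V : lmodType R) (N : submodule V) : {linear V -> quotient N} :=
  mklin (proj_linear N).

Lemma proj_eq (V : lmodType R) (N : submodule V) x y : proj N x = proj N y <-> N (x - y).
Proof. exact: quot_eq. Qed.

Lemma proj_eq0 (V : lmodType R) (N : submodule V) x : proj N x = 0 <-> N x.
Proof. by rewrite -(linear0 (proj N)) proj_eq subr0. Qed.

Lemma proj_surj (V : lmodType R) (N : submodule V) : surj (proj N).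
Proof. by elim/pq_ind=> x; exists x. Qed.

Lemma quot_lift (V W : lmodType R) (N : submodule V) (f : {linear V -> W}) :
  (forall x, N x -> f x = 0) ->
  exists g : {linear quotient N -> W}, forall x, g (proj N x) = f x.
Proof.
move=> f0.
have [] := @choose_linear (quotient N) W (fun u y => forall x, proj N x = u -> f x = y).
- move=> u; have [x <-] := proj_surj u; exists (f x) => x' /proj_eq /f0.
  by rewrite linearB => /eqP; rewrite subr_eq0 => /eqP.
- by move=> u y y'; have [x xu] := proj_surj u; move=> /(_ x xu) <- /(_ x xu).
- move=> a u u' y y'; have [x xu] := proj_surj u; have [x' xu'] := proj_surj u'.
  move=> /(_ x xu) <- /(_ x' xu') <- z; rewrite -xu -xu' -linearP.
  by move=> /proj_eq /f0; rewrite !linearB linearP => /eqP; rewrite subr_eq0 => /eqP.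
by move=> g hg; exists g => x; rewrite -(hg _ x erefl).
Qed.

Lemma ker_sub_lin (U V : lmodType R) (d : {linear U -> V}) a x y :
  d x = 0 -> d y = 0 -> d (a *: x + y) = 0.
Proof. by move=> dx dy; rewrite linearP dx dy scaler0 addr0. Qed.

Definition ker_sub (U V : lmodType R) (d : {linear U -> V}) : submodule U :=
  Submodule (linear0 d) (ker_sub_lin (d := d)).

(** A projective module lifts along any [d] whose image contains that of [g],
even if [d] is not surjective: [g] factors through U / ker d, which is
isomorphic to the image of [d]. *)
Lemma proj_lift (M U V : lmodType R) (d : {linear U -> V}) (g : {linear M -> V}) :
  projective_module M -> (forall x, exists u, d u = g x) ->
  exists h : {linear M -> U}, forall x, d (h x) = g x.
Proof.
move=> Mproj gd.
have [] := @choose_linear M (quotient (ker_sub d))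
  (fun x y => forall u, d u = g x -> proj (ker_sub d) u = y).
- move=> x; have [u du] := gd x; exists (proj (ker_sub d) u) => u' du'.
  by apply/proj_eq; rewrite /= linearB du du' subrr.
- by move=> x y y'; have [u du] := gd x; move=> /(_ _ du) <- /(_ _ du).
- move=> a x x' y y'; have [u du] := gd x; have [u' du'] := gd x'.
  move=> /(_ _ du) <- /(_ _ du') <- v dv; rewrite -linearP; apply/proj_eq => /=.
  by rewrite linearB linearP dv linearP du du' subrr.
move=> g' hg'; have [h hh] := Mproj _ _ _ g' (@proj_surj _ (ker_sub d)).
exists h => x; have [u du] := gd x.
have /proj_eq /= := etrans (hh x) (esym (hg' x u du)).
by rewrite linearB du => /eqP; rewrite subr_eq0 => /eqP.
Qed.

Section Kernel.
Variables (V W : lmodType R) (g : {linear V -> W}).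

(** The cycles of V -> V -> W with zero first map are taken modulo 0 only, so
this homology is the kernel of [g]. *)
Definition ker_mod : lmodType R := homology (\0 : {linear V -> V}) g.
Definition ker_incl_fun (u : ker_mod) : V := sval (pq_repr u).

Let P := homology_pre (\0 : {linear V -> V}) g.

Lemma ker_incl_pq (x : P) : ker_incl_fun (pq x) = sval x.
Proof.
have [u /=] := pq_repr_eq (P := P) x.
by move/eqP; rewrite subr_eq0 => /eqP.
Qed.

Lemma ker_incl_linear : linear ker_incl_fun.
Proof.
move=> a; elim/pq_ind=> x; elim/pq_ind=> y.
by rewrite pqZ pqD !ker_incl_pq.
Qed.

Definition ker_incl : {linear ker_mod -> V} := mklin ker_incl_linear.

Lemma ker_incl_exact : exact_at ker_incl g.
Proof.
move=> y; split=> [gy | [u <-]]; last by rewrite /= /ker_incl_fun; case: (pq_repr u).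
by exists (pq (P := P) (exist _ y gy)); rewrite /= ker_incl_pq.
Qed.
End Kernel.

End LinearMaps.

Section TensorData.
Variables (k : comPzRingType) (R : pzRingType) (T : tensor_data k R).

Lemma td_ind (Q : td_mod T -> Prop) :
  Q 0 -> (forall u v, Q u -> Q v -> Q (u + v)) -> (forall t, Q (td_in t)) ->
  forall u, Q u.
Proof.
move=> Q0 QD Qt; elim/pq_ind=> s; rewrite td_spanE.
elim: s => [|t s IHs]; first by rewrite big_nil.
by rewrite big_cons; apply: QD.
Qed.

(** [g] will be the action of a scalar on [V]: an action on [V] that is not
the one of k is only available as an additive map. *)
Lemma td_lift_scale (V : lmodType k) (phi : T -> V) (g : V -> V) (a : R) u :
  td_ok phi -> g 0 = 0 -> {morph g : x y / x + y} ->
  (forall t, phi (td_scale a t) = g (phi t)) ->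
  td_lift phi (a *: u) = g (td_lift phi u).
Proof.
move=> phi_ok g0 gD gphi; elim/pq_ind: u => s.
rewrite pqZ !td_liftE //= td_sum_map /td_sum.
elim: s => [|t s IHs]; first by rewrite !big_nil.
by rewrite !big_cons gD IHs /= gphi.
Qed.
End TensorData.

Section TensorOverAlgebra.
Variables (k : comPzRingType) (A : kalgebra k).

Lemma atens_pureDl (L : lmodType A^c) (N : lmodType A) (l l' : L) (n : N) :
  atens_pure (l + l') n = atens_pure l n + atens_pure l' n.
Proof.
rewrite pqD; apply/pqP => V phi [hD _ _ _].
by rewrite /td_sum !big_cons !big_nil !addr0.
Qed.

Lemma atens_pureDr (L : lmodType A^c) (N : lmodType A) (l : L) (n n' : N) :
  atens_pure l (n + n') = atens_pure l n + atens_pure l n'.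
Proof.
rewrite pqD; apply/pqP => V phi [_ hD _ _].
by rewrite /td_sum !big_cons !big_nil !addr0.
Qed.

Lemma atens_pure_act (L : lmodType A^c) (N : lmodType A) (a : A) (l : L) (n : N) :
  atens_pure ((a : A^c) *: l) n = atens_pure l (a *: n).
Proof.
by apply/pqP => V phi [_ _ ha _]; rewrite /td_sum !big_cons !big_nil !addr0.
Qed.

Lemma atens_pureZ (L : lmodType A^c) (N : lmodType A) (c : k) (l : L) (n : N) :
  atens_pure l (alg_map A c *: n) = c *: atens_pure l n.
Proof. by rewrite -td_in_scale. Qed.

Lemma atens_pure0r (L : lmodType A^c) (N : lmodType A) (l : L) :
  atens_pure l (0 : N) = 0.
Proof. by apply: (addrI (atens_pure l (0 : N))); rewrite -atens_pureDr !addr0. Qed.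

Lemma atens_pure0l (L : lmodType A^c) (N : lmodType A) (n : N) :
  atens_pure (0 : L) n = 0.
Proof. by apply: (addrI (atens_pure (0 : L) n)); rewrite -atens_pureDl !addr0. Qed.

Lemma atens_ind (L : lmodType A^c) (N : lmodType A) (Q : atens L N -> Prop) :
  Q 0 -> (forall u v, Q u -> Q v -> Q (u + v)) ->
  (forall l n, Q (atens_pure l n)) -> forall u, Q u.
Proof. by move=> Q0 QD Qp; apply: td_ind; [| |case]. Qed.

Lemma atens_lift (L : lmodType A^c) (N : lmodType A) (V : lmodType k)
    (phi : L -> N -> V) : abalanced phi ->
  exists h : {linear atens L N -> V}, forall l n, h (atens_pure l n) = phi l n.
Proof.
move=> hphi; pose psi (t : atens_data L N) : V := phi t.1 t.2.
have psi_ok : @td_ok _ _ (atens_data L N) V psi by [].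
have psi_lin : linear (td_lift psi).
  move=> c x y; rewrite td_liftD //; congr (_ + _).
  apply: td_lift_scale => //; [exact: scaler0 | exact: scalerDr |].
  by move=> [l n]; rewrite /psi /= (abal_Z hphi).
by exists (mklin psi_lin) => l n; rewrite mklinE td_lift_in.
Qed.

Lemma atens_mapE (L L' : lmodType A^c) (N : lmodType A) (d : {linear L -> L'}) l (n : N) :
  atens_map N d (atens_pure l n) = atens_pure (d l) n.
Proof. by rewrite /atens_map /= /atens_map_fun td_mapE //; apply: atens_gen_map_ok. Qed.

Lemma atens_pure_balanced (L : lmodType A^c) (N N' : lmodType A) (E : {linear N -> N'}) :
  abalanced (fun (l : L) n => atens_pure l (E n)).
Proof.
split=> [l l' n | l n n' | a l n | c l n].
- exact: atens_pureDl.
- by rewrite linearD atens_pureDr.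
- by rewrite atens_pure_act linearZ.
- by rewrite linearZ /= atens_pureZ.
Qed.

Definition atens_mapr (L : lmodType A^c) (N N' : lmodType A) (E : {linear N -> N'}) :
    {linear atens L N -> atens L N'} :=
  sval (cid (atens_lift (@atens_pure_balanced L _ _ E))).

Lemma atens_maprE (L : lmodType A^c) (N N' : lmodType A) (E : {linear N -> N'})
    (l : L) n :
  atens_mapr L E (atens_pure l n) = atens_pure l (E n).
Proof. exact: (svalP (cid (atens_lift (@atens_pure_balanced L _ _ E)))). Qed.

Lemma atens_mapC (L L' : lmodType A^c) (N N' : lmodType A) (d : {linear L -> L'})
    (E : {linear N -> N'}) z :
  atens_map N' d (atens_mapr L E z) = atens_mapr L' E (atens_map N d z).
Proof.
elim/atens_ind: z => [|u v IHu IHv|l n]; first by rewrite !linear0.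
  by rewrite !linearD IHu IHv.
by rewrite !(atens_mapE, atens_maprE).
Qed.

Lemma atens_mapr_surj (L : lmodType A^c) (N N' : lmodType A) (E : {linear N -> N'}) :
  surj E -> surj (atens_mapr L E).
Proof.
move=> Es; elim/atens_ind=> [|u v [x <-] [y <-]|l n].
- by exists 0; rewrite linear0.
- by exists (x + y); rewrite linearD.
- by have [m <-] := Es n; exists (atens_pure l m); rewrite atens_maprE.
Qed.

End TensorOverAlgebra.

(** * Flatness of a quotient of a locally projective module *)

Section FlatModules.
Variables (k : comPzRingType) (A : kalgebra k).

Lemma atens_mapr_comp (L : lmodType A^c) (N1 N2 N3 : lmodType A)
    (E : {linear N1 -> N2}) (F : {linear N2 -> N3}) (G : {linear N1 -> N3}) :
  (forall x, F (E x) = G x) ->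
  forall z, atens_mapr L F (atens_mapr L E z) = atens_mapr L G z.
Proof.
move=> FE; elim/atens_ind=> [|u v IHu IHv|l n]; first by rewrite !linear0.
  by rewrite !linearD IHu IHv.
by rewrite !atens_maprE FE.
Qed.

Lemma atens_mapr_id (L : lmodType A^c) (N : lmodType A) z :
  atens_mapr L (idfun : {linear N -> N}) z = z.
Proof.
elim/atens_ind: z => [|u v IHu IHv|l n]; first by rewrite linear0.
  by rewrite linearD IHu IHv.
by rewrite atens_maprE.
Qed.

(** A dual basis of finite length for each finite set of elements; it may depend
on the set, so that free modules of infinite rank qualify. *)
Definition locally_projective (N : lmodType A) : Prop :=
  forall ns : seq N, exists (n : nat) (u : 'I_n -> N) (c : 'I_n -> {linear N -> A^o}),
    forall x, x \in ns -> x = \sum_i (c i x : A) *: u i.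

(** Property (V) for a linear map. *)
Definition kernel_killed (N Y : lmodType A) (E : {linear N -> Y}) : Prop :=
  forall x, E x = 0 ->
    exists2 psi : {linear N -> N}, (forall y, E (psi y) = E y) & psi x = 0.

Section Killing.
Variables (N Y : lmodType A) (E : {linear N -> Y}) (L : lmodType A^c).

(** Two elements are to be annihilated by one and the same map. Asking for [psi]
after every correction [psi0] makes these elements a submodule: first
annihilate u, then the image of v. *)
Definition killable (z : atens L N) : Prop :=
  forall psi0 : {linear N -> N}, (forall y, E (psi0 y) = E y) ->
  exists2 psi : {linear N -> N}, (forall y, E (psi y) = E y) &
    atens_mapr L psi (atens_mapr L psi0 z) = 0.

Lemma killable0 : killable 0.
Proof. by move=> psi0 _; exists idfun => //; rewrite !linear0. Qed.

Lemma killable_lin (a : k) u v : killable u -> killable v -> killable (a *: u + v).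
Proof.
move=> hu hv psi0 E0; have [psi1 E1 k1] := hu _ E0.
have [|psi2 E2 k2] := hv (psi1 \o psi0); first by move=> y; rewrite /= E1 E0.
exists (psi2 \o psi1) => [y|]; first by rewrite /= E2 E1.
rewrite !linearP /= -(atens_mapr_comp (F := psi2) (E := psi1)) // k1 linear0 scaler0 add0r.
rewrite -(atens_mapr_comp (F := psi2) (E := psi1)) //.
by rewrite (atens_mapr_comp (F := psi1) (E := psi0) (G := psi1 \o psi0)).
Qed.

Definition killable_sub := Submodule killable0 killable_lin.

(** The kernel of L (x) N -> L (x) Y is spanned by the l (x) n with E n = 0, which
are killable. To avoid the explicit description of that kernel, the inverse map
L (x) Y -> (L (x) N) / killable is built from lifts of the elements of Y. *)
Lemma atens_kernel_killed : surj E -> kernel_killed E ->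
  forall z, atens_mapr L E z = 0 ->
  exists2 psi : {linear N -> N}, (forall y, E (psi y) = E y) & atens_mapr L psi z = 0.
Proof.
move=> /choice [s Es] Ek.
have pure_eq l n n' : E n = E n' ->
    proj killable_sub (atens_pure l n) = proj killable_sub (atens_pure l n').
  move=> Enn'; apply/proj_eq => psi0 E0.
  have [|psi E1 k1] := Ek (psi0 (n - n')); first by rewrite E0 linearB Enn' subrr.
  exists psi => //; rewrite !linearB !atens_maprE.
  apply/eqP; rewrite subr_eq0; apply/eqP; congr atens_pure.
  by move/eqP: k1; rewrite !linearB subr_eq0 => /eqP.
have bal : abalanced (fun l y => proj killable_sub (atens_pure l (s y))).
  split=> [l l' n | l n n' | a l n | c l n].
  - by rewrite atens_pureDl linearD.
  - by rewrite -linearD -atens_pureDr; apply: pure_eq; rewrite linearD !Es.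
  - by rewrite atens_pure_act; apply: pure_eq; rewrite linearZ /= !Es.
  - rewrite -linearZ -atens_pureZ; apply: pure_eq.
    by rewrite linearZ /= !Es.
have [h hE] := atens_lift bal.
have hproj z : h (atens_mapr L E z) = proj killable_sub z.
  elim/atens_ind: z => [|u v IHu IHv|l n]; first by rewrite !linear0.
    by rewrite !linearD IHu IHv.
  by rewrite atens_maprE hE; apply: pure_eq; rewrite Es.
move=> z Ez; have : proj killable_sub z = 0 by rewrite -hproj Ez linear0.
move=> /proj_eq0 /(_ idfun) [] // psi Epsi.
by rewrite atens_mapr_id; exists psi.
Qed.

End Killing.

Lemma atens_coord (L : lmodType A^c) (N : lmodType A) (c : {linear N -> A^o}) :
  exists h : {linear atens L N -> restr (A := opp_alg A) L},
    forall l n, h (atens_pure l n) = (c n : A^c) *: l.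
Proof.
have bal : abalanced (V := restr (A := opp_alg A) L) (fun (l : L) n => (c n : A^c) *: l).
  split=> [l l' n | l n n' | a l n | a l n].
  - exact: (@scalerDr A^c L).
  - by rewrite linearD; apply: (@scalerDl A^c L).
  - by rewrite scalerA linearZ.
  - rewrite linearZ /=; transitivity ((alg_map A a : A^c) *: ((c n : A^c) *: l)) => //.
    by rewrite scalerA; apply: (congr1 (fun b : A^c => b *: l)); apply: alg_central.
exact: atens_lift bal.
Qed.

Lemma atens_eval (L : lmodType A^c) (N : lmodType A) (lam : {linear L -> A^c^o}) :
  exists h : {linear atens L N -> restr N},
    forall l n, h (atens_pure l n) = (lam l : A) *: n.
Proof.
have bal : abalanced (V := restr N) (fun (l : L) n => (lam l : A) *: n).
  split=> [l l' n | l n n' | a l n | a l n].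
  - by rewrite linearD; apply: (@scalerDl A N).
  - exact: (@scalerDr A N).
  - by rewrite linearZ scalerA.
  - transitivity (alg_map A a *: ((lam l : A) *: n)) => //.
    by rewrite !scalerA alg_central.
exact: atens_lift bal.
Qed.

Lemma atens_complex (L1 L2 L3 : lmodType A^c) (N : lmodType A)
    (f : {linear L1 -> L2}) (g : {linear L2 -> L3}) :
  (forall x, g (f x) = 0) -> forall z, atens_map N g (atens_map N f z) = 0.
Proof.
move=> gf; elim/atens_ind=> [|u v IHu IHv|l n]; first by rewrite !linear0.
  by rewrite !linearD IHu IHv addr0.
by rewrite !atens_mapE gf atens_pure0l.
Qed.

(** With a dual basis (u_i, c_i) for the right factors of z, one has
z = sum_i h_i(z) (x) u_i where h_i contracts the right factor by c_i. The h_i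
commute with [f] and [g], so the exactness can be used coordinate by
coordinate. *)
Lemma locally_projective_flat (N : lmodType A) : locally_projective N -> flat_module N.
Proof.
move=> Nproj L1 L2 L3 f g fg z; split=> [gz | [x <-]]; last first.
  by apply: atens_complex => y; apply/fg; exists y.
have [s [n [u [c hz]]]] : exists (s : seq (L2 * N)) (n : nat) (u : 'I_n -> N)
    (c : 'I_n -> {linear N -> A^o}),
    z = \sum_(t <- s) atens_pure t.1 t.2 /\
    forall t, t \in s -> t.2 = \sum_i (c i t.2 : A) *: u i.
  elim/pq_ind: z {gz} => s; have [n [u [c hc]]] := Nproj (map snd s).
  exists s, n, u, c; split=> [|t ts]; last by apply: hc; apply: map_f.
  by rewrite td_spanE; apply: eq_bigr => -[].
case: hz => zE hc.
have [h2 h2E] := choice (fun i => atens_coord L2 (c i)).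
have zsum : z = \sum_i atens_pure (h2 i z : L2) (u i).
  have pure_sum (J : Type) (r : seq J) (F : J -> L2) m :
      atens_pure (\sum_(j <- r) F j) m = \sum_(j <- r) atens_pure (F j) m :> atens L2 N.
    elim: r => [|j r IHr]; first by rewrite !big_nil atens_pure0l.
    by rewrite !big_cons atens_pureDl IHr.
  have pure_sumr l (F : 'I_n -> N) :
      atens_pure l (\sum_i F i) = \sum_i atens_pure l (F i) :> atens L2 N.
    apply: (big_morph (atens_pure l)); [exact: atens_pureDr | exact: atens_pure0r].
  transitivity (\sum_i \sum_(t <- s) atens_pure ((c i t.2 : A^c) *: t.1) (u i)).
    rewrite exchange_big zE /=; apply: eq_big_seq => t /hc {1}->.
    by rewrite pure_sumr; apply: eq_bigr => i _; rewrite atens_pure_act.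
  apply: eq_bigr => i _; rewrite -pure_sum zE linear_sum; congr atens_pure.
  by apply: eq_bigr => t _; rewrite h2E.
have preim i : exists x, f x = h2 i z.
  have [h3 h3E] := atens_coord L3 (c i).
  have gh w : g (h2 i w) = h3 (atens_map N g w).
    elim/atens_ind: w => [|v w IHv IHw|l m]; first by rewrite !linear0.
      by rewrite !linearD -IHv -IHw.
    by rewrite atens_mapE h2E h3E; exact: (linearZ_LR g).
  by apply/fg; rewrite gh gz linear0.
have [x xE] := choice preim.
exists (\sum_i atens_pure (x i) (u i)); rewrite linear_sum [RHS]zsum.
by apply: eq_bigr => i _; rewrite atens_mapE xE.
Qed.

(** Lift z to L2 (x) N. A correction annihilates its image in L3 (x) N, and the
corrected lift comes from L1 (x) N, as N is flat. *)
Lemma kernel_killed_flat (N Y : lmodType A) (E : {linear N -> Y}) :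
  surj E -> locally_projective N -> kernel_killed E -> flat_module Y.
Proof.
move=> Es Nproj Ek L1 L2 L3 f g fg z; split=> [gz | [x <-]]; last first.
  by apply: atens_complex => y; apply/fg; exists y.
have [w wz] := atens_mapr_surj (L := L2) Es z.
have [|psi Epsi k1] := @atens_kernel_killed _ _ E L3 Es Ek (atens_map N g w).
  by rewrite -atens_mapC wz.
have /(locally_projective_flat Nproj fg) [v vE] : atens_map N g (atens_mapr L2 psi w) = 0.
  by rewrite atens_mapC k1.
exists (atens_mapr L1 E v); rewrite atens_mapC vE.
by rewrite (atens_mapr_comp (G := E)).
Qed.

(** This is the equational criterion for one relation. Write x = sum_i a_i u_i
in a dual basis. Then sum_i a_i E(u_i) = 0, and flatness applied to the kernel of
b |-> sum_i a_i b_i in A^n gives elements u'_i of N over the E(u_i) with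
sum_i a_i u'_i = 0. The correction replaces each u_i by u'_i. *)
Lemma flat_kernel_killed (N Y : lmodType A) (E : {linear N -> Y}) :
  surj E -> locally_projective N -> flat_module Y -> kernel_killed E.
Proof.
move=> Es Nproj Yflat x Ex.
have [n [u [c xE]]] := Nproj [:: x].
have {}xE := xE x (mem_head _ _).
pose L2 : lmodType A^c := {ffun 'I_n -> A^c^o}; pose L3 : lmodType A^c := A^c^o.
pose gf (b : L2) : L3 := \sum_i ((c i x : A) * (b i : A) : A).
have glin : linear gf.
  move=> a b b'; rewrite /gf scaler_sumr -big_split /=; apply: eq_bigr => i _.
  rewrite !ffunE mulrDr; congr (_ + _); exact: (@mulrA A (c i x) (b i) a).
pose g := mklin glin; pose f := ker_incl g.
(* the canonical basis of A^n *)
pose eps i : L2 := [ffun j => if j == i then (1 : A^c^o) else 0].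
have [v vE] : exists v, atens_map Y f v = \sum_i atens_pure (eps i) (E (u i)).
  apply/(Yflat _ _ _ f g); first exact: ker_incl_exact.
  (* g sends the i-th basis vector to a_i, and a_i (x) y = 1 (x) a_i y. *)
  have -> : atens_map Y g (\sum_i atens_pure (eps i) (E (u i))) =
            atens_pure (1 : L3) (E x).
    rewrite linear_sum {1}xE linear_sum.
    rewrite (big_morph _ (@atens_pureDr _ _ L3 Y 1) (@atens_pure0r _ _ L3 Y 1)).
    apply: eq_bigr => i _; rewrite linearZ -atens_pure_act atens_mapE.
    congr atens_pure; rewrite /= /gf (bigD1 i) //= big1 ?addr0.
      by rewrite ffunE eqxx mulr1; apply: esym; apply: (@mul1r A).
    by move=> j /negbTE ji; rewrite ffunE ji mulr0.
  by rewrite Ex atens_pure0r.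
have [w wv] := atens_mapr_surj (L := ker_mod g) Es v.
have coord_lin i : linear (fun b : L2 => b i : A^c^o) by move=> a b b'; rewrite !ffunE.
have [h hE] := choice (fun i => atens_eval N (mklin (coord_lin i))).
pose u' i : N := h i (atens_map N f w).
have Eu' i : E (u' i) = E (u i).
  have [hY hYE] := atens_eval Y (mklin (coord_lin i)).
  have EhY z : E (h i z) = hY (atens_mapr L2 E z).
    elim/atens_ind: z => [|z z' IHz IHz'|l m]; first by rewrite !linear0.
      by rewrite !linearD -IHz -IHz'.
    by rewrite atens_maprE hYE hE (linearZ_LR E).
  rewrite /u' EhY -atens_mapC wv vE linear_sum (bigD1 i) //= big1 ?addr0.
    by rewrite hYE /= ffunE eqxx scale1r.
  by move=> j ji; rewrite hYE /= ffunE eq_sym (negbTE ji) scale0r.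
have u'0 : \sum_i (c i x : A) *: u' i = 0.
  have [hg hgE] := atens_eval N g.
  have -> : \sum_i (c i x : A) *: u' i = hg (atens_map N f w).
    rewrite /u'; move: (atens_map N f w) => z.
    elim/atens_ind: z => [|z z' IHz IHz'|l m].
    - by rewrite linear0 big1 // => i _; rewrite linear0 scaler0.
    - rewrite linearD -IHz -IHz' -big_split; apply: eq_bigr => i _.
      by rewrite linearD; apply: (@scalerDr A N).
    - rewrite hgE /= /gf scaler_suml; apply: eq_bigr => i _.
      by rewrite hE; apply: (@scalerA A N).
  elim/atens_ind: w {wv u' Eu'} => [|z z' IHz IHz'|l m]; first by rewrite !linear0.
    by rewrite !linearD IHz IHz' addr0.
  have /(_ (f l)) [_ gf0] := ker_incl_exact g.
  by rewrite atens_mapE hgE gf0 ?scale0r //; exists l.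
have psi_lin : linear (fun y => y - \sum_i (c i y : A) *: (u i - u' i)).
  move=> a y y'; rewrite scalerBr scaler_sumr addrACA -opprD -big_split /=.
  congr (_ - _); apply: eq_bigr => i _.
  by rewrite linearP scalerDl; congr (_ + _); rewrite scalerA.
exists (mklin psi_lin) => [y|]; rewrite mklinE.
  rewrite linearB linear_sum big1 ?subr0 // => i _.
  by rewrite linearZ /= linearB Eu' subrr scaler0.
under eq_bigr do rewrite scalerBr.
by rewrite sumrB u'0 subr0 -xE subrr.
Qed.

End FlatModules.

(** * Functors: quotients, epimorphisms and free functors *)

Section Functors.
Variables (k : comPzRingType) (C : klincat k) (R : pzRingType) (eta : k -> R).
Implicit Types F G H : klfun C eta.

Definition fmor_id F : fmor F F := @FMor _ _ _ _ F F (fun p => idfun) (fun p q f x => erefl).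

Lemma fmor_comp_nat F G H (v : fmor G H) (u : fmor F G) p q (f : hom p q) x :
  (v q \o u q) (fact F f x) = fact H f ((v p \o u p) x).
Proof. by rewrite /= !fcomp_nat. Qed.

Definition fmor_comp F G H (v : fmor G H) (u : fmor F G) : fmor F H :=
  @FMor _ _ _ _ F H (fun p => v p \o u p) (@fmor_comp_nat F G H v u).

Lemma fmor0_nat F G p q (f : hom p q) x :
  (\0 : {linear F q -> G q}) (fact F f x) = fact G f ((\0 : {linear F p -> G p}) x).
Proof. by rewrite /= linear0. Qed.

Definition fmor0 F G : fmor F G := @FMor _ _ _ _ F G (fun p => \0) (@fmor0_nat F G).

Lemma surj_epi F G (e : fmor F G) : (forall p, surj (e p)) -> epi e.
Proof. by move=> es Z u v uv p y; have [x <-] := es p y. Qed.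

Record subfunctor F := SubFunctor {
  sf_val :> forall p, submodule (F p);
  sf_act : forall p q (f : hom p q) x, sf_val p x -> sf_val q (fact F f x)
}.

Section Quotient.
Variables (F : klfun C eta) (N : subfunctor F).

Definition quot_act_fun p q (f : hom p q) (u : quotient (N p)) : quotient (N q) :=
  proj (N q) (fact F f (pq_repr u)).

Lemma quot_actE p q (f : hom p q) x :
  quot_act_fun f (proj (N p) x) = proj (N q) (fact F f x).
Proof.
apply/proj_eq; rewrite -linearB; apply: sf_act.
exact: (pq_repr_eq (P := quot_pre (N p)) x).
Qed.

Lemma quot_act_linear p q (f : hom p q) : linear (quot_act_fun f).
Proof.
move=> a u v; have [x <-] := proj_surj u; have [y <-] := proj_surj v.
by rewrite -linearP !quot_actE !linearP.
Qed.

Definition quot_act p q (f : hom p q) : {linear quotient (N p) -> quotient (N q)} :=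
  mklin (quot_act_linear f).

Lemma quot_actP p q (f : hom p q) x :
  quot_act f (proj (N p) x) = proj (N q) (fact F f x).
Proof. exact: quot_actE. Qed.

Lemma quot_act_lin p q (a : k) (f g : hom p q) u :
  quot_act (a *: f + g) u = eta a *: quot_act f u + quot_act g u.
Proof. by have [x <-] := proj_surj u; rewrite !quot_actP fact_lin linearP. Qed.

Lemma quot_act_id p u : quot_act (idm p) u = u.
Proof. by have [x <-] := proj_surj u; rewrite quot_actP fact_id. Qed.

Lemma quot_act_comp p q r (g : hom q r) (f : hom p q) u :
  quot_act (comp g f) u = quot_act g (quot_act f u).
Proof. by have [x <-] := proj_surj u; rewrite !quot_actP fact_comp. Qed.

Definition quot_fun : klfun C eta :=
  KLFun quot_act_lin quot_act_id quot_act_comp.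

Lemma quot_proj_nat p q (f : hom p q) x :
  proj (N q) (fact F f x) = fact quot_fun f (proj (N p) x).
Proof. exact: esym (quot_actP f x). Qed.

Definition quot_proj : fmor F quot_fun :=
  @FMor _ _ _ _ F quot_fun (fun p => proj (N p)) quot_proj_nat.

Lemma quot_proj_surj p : surj (quot_proj p).
Proof. exact: proj_surj. Qed.

Lemma quot_proj_eq0 p x : quot_proj p x = 0 <-> N p x.
Proof. exact: proj_eq0. Qed.

Lemma quot_mor G (u : fmor F G) : (forall p x, N p x -> u p x = 0) ->
  exists v : fmor quot_fun G, forall p x, v p (quot_proj p x) = u p x.
Proof.
move=> u0; have [v vE] := dep_choice (fun p => quot_lift (u0 p)).
have vnat p q (f : hom p q) y : v q (fact quot_fun f y) = fact G f (v p y).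
  by have [x <-] := quot_proj_surj y; rewrite -fcomp_nat !vE fcomp_nat.
by exists (FMor vnat).
Qed.

End Quotient.

Lemma image_lin F G (e : fmor F G) p a (y y' : G p) :
  (exists x, e p x = y) -> (exists x, e p x = y') -> exists x, e p x = a *: y + y'.
Proof. by move=> [x <-] [x' <-]; exists (a *: x + x'); rewrite linearP. Qed.

Lemma image0 F G (e : fmor F G) p : exists x, e p x = 0.
Proof. by exists 0; rewrite linear0. Qed.

Lemma image_act F G (e : fmor F G) p q (f : hom p q) y :
  (exists x, e p x = y) -> exists x, e q x = fact G f y.
Proof. by move=> [x <-]; exists (fact F f x); rewrite fcomp_nat. Qed.

Definition image_fun F G (e : fmor F G) : subfunctor G :=
  SubFunctor (sf_val := fun p => Submodule (@image0 F G e p) (@image_lin F G e p))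
    (@image_act F G e).

(** Compare the projection to the cokernel with the zero morphism. *)
Lemma epi_surj F G (e : fmor F G) : epi e -> forall p, surj (e p).
Proof.
move=> ee p y; apply/(@quot_proj_eq0 _ (image_fun e)).
apply: (ee _ (quot_proj (image_fun e)) (fmor0 _ _)) => q x.
by apply/quot_proj_eq0; exists x.
Qed.

End Functors.

Section Free.
Variables (k : comPzRingType) (C : klincat k) (A : kalgebra k).
Variables (I : Type) (q : I -> C).

(** The maps that factor through A (x)_k hom (q i) p for every i. *)
Record free_balanced p (V : lmodType k) (phi : A -> forall i, hom (q i) p -> V) :
    Prop := FreeBalanced {
  fb_addl : forall a b i f, phi (a + b) i f = phi a i f + phi b i f;
  fb_scalel : forall c a i f, phi (alg_map A c * a) i f = c *: phi a i f;
  fb_linr : forall a i c f g, phi a i (c *: f + g) = c *: phi a i f + phi a i g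
}.

Definition free_gen (p : C) : Type := (A * {i : I & hom (q i) p})%type.

Definition free_ok p (V : lmodType k) (phi : free_gen p -> V) : Prop :=
  free_balanced (fun a i f => phi (a, existT _ i f)).

Program Definition free_data p : tensor_data k A :=
  @TensorData k A (free_gen p) (@free_ok p) (fun a t => (a * t.1, t.2)) _ _ _ _.
Next Obligation.
case: H => hD hZ hl; split=> /= [b c i f | c b i f | b i c f g].
- by rewrite mulrDr hD.
- by rewrite mulrA -alg_central -mulrA hZ.
- exact: hl.
Qed.
Next Obligation. by rewrite mul1r; case: t. Qed.
Next Obligation. by rewrite mulrA. Qed.
Next Obligation. by case: H => hD _ _; case: t => a0 [i f]; rewrite mulrDl hD. Qed.

(** The value at [p] of the sum of the A (x)_k C(q_i, -). The universal property
is that of the tensor product, for maps to k-modules; the one among functors is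
[free_mor]. *)
Definition free_obj p : lmodType A := td_mod (free_data p).

Definition free_elt p (a : A) i (f : hom (q i) p) : free_obj p :=
  td_in (T := free_data p) (a, existT _ i f).

Lemma free_elt_scale p a b i (f : hom (q i) p) :
  a *: free_elt b f = free_elt (a * b) f.
Proof. by rewrite -td_in_scale. Qed.

Lemma free_elt_lin p a (c : k) i (f g : hom (q i) p) :
  free_elt a (c *: f + g) = alg_map A c *: free_elt a f + free_elt a g.
Proof.
rewrite free_elt_scale pqD; apply/pqP => V phi [_ hZ hl].
by rewrite /td_sum !big_cons !big_nil !addr0 hl hZ.
Qed.

Lemma free_elt_ind p (Q : free_obj p -> Prop) :
  Q 0 -> (forall u v, Q u -> Q v -> Q (u + v)) ->
  (forall a i f, Q (@free_elt p a i f)) -> forall u, Q u.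
Proof. by move=> Q0 QD Qp; apply: td_ind; [| |case=> a0 [i0 f0]; apply: Qp]. Qed. 

Definition free_gen_act p p' (h : hom p p') (t : free_data p) : free_data p' :=
  (t.1, existT _ (tag t.2) (comp h (tagged t.2))).

Lemma free_gen_act_ok p p' (h : hom p p') (V : lmodType k) (phi : free_data p' -> V) :
  td_ok phi -> td_ok (phi \o free_gen_act h).
Proof.
case=> hD hZ hl; split=> /= [a b i f | c a i f | a i c f g].
- by rewrite /free_gen_act /= hD.
- by rewrite /free_gen_act /= hZ.
- by rewrite /free_gen_act /= (comp_linr h) hl.
Qed.

Lemma free_act_linear p p' (h : hom p p') : linear (td_map (free_gen_act h)).
Proof. by apply: td_map_linear => //; apply: free_gen_act_ok. Qed.

Definition free_act p p' (h : hom p p') : {linear free_obj p -> free_obj p'} :=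
  mklin (free_act_linear h).

Lemma free_actE p p' (h : hom p p') a i (f : hom (q i) p) :
  free_act h (free_elt a f) = free_elt a (comp h f).
Proof. by rewrite /free_act mklinE td_mapE //; apply: free_gen_act_ok. Qed.

Lemma free_act_lin p p' (c : k) (g h : hom p p') x :
  free_act (c *: g + h) x = alg_map A c *: free_act g x + free_act h x.
Proof.
elim/free_elt_ind: x => [|u v IHu IHv|a i f]; first by rewrite !linear0 scaler0 addr0.
  by rewrite !linearD IHu IHv scalerDr addrACA.
by rewrite !free_actE (comp_linl f) free_elt_lin.
Qed.

Lemma free_act_id p x : free_act (idm p) x = x.
Proof.
elim/free_elt_ind: x => [|u v IHu IHv|a i f]; first by rewrite linear0.
  by rewrite linearD IHu IHv.
by rewrite free_actE comp1m.
Qed.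

Lemma free_act_comp p p' p'' (g : hom p' p'') (h : hom p p') x :
  free_act (comp g h) x = free_act g (free_act h x).
Proof.
elim/free_elt_ind: x => [|u v IHu IHv|a i f]; first by rewrite !linear0.
  by rewrite !linearD IHu IHv.
by rewrite !free_actE compA.
Qed.

Definition free_fun : lMod C A := KLFun free_act_lin free_act_id free_act_comp.

Definition gen i : free_fun (q i) := free_elt 1 (idm (q i)).

Lemma free_eltE p a i (f : hom (q i) p) : free_elt a f = a *: fact free_fun f (gen i).
Proof. by rewrite [fact _ _ _](@free_actE _ _ f 1 i (idm (q i))) compm1 free_elt_scale mulr1. Qed.

Lemma free_ind p (Q : free_fun p -> Prop) :
  Q 0 -> (forall u v, Q u -> Q v -> Q (u + v)) ->
  (forall (a : A) i f, Q (a *: fact free_fun f (gen i))) -> forall u, Q u.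
Proof.
by move=> Q0 QD Qp; apply: free_elt_ind => // a i f; rewrite free_eltE.
Qed.

(** Maps out of a value of the free functor that need not come from a morphism of
functors. *)
Lemma free_lift p (V : lmodType k) (phi : A -> forall i, hom (q i) p -> V) :
  free_balanced phi ->
  exists h : {linear restr (free_fun p) -> V},
    forall (a : A) i f, h (a *: fact free_fun f (gen i)) = phi a i f.
Proof.
move=> hphi; pose psi (t : free_data p) : V := phi t.1 (tag t.2) (tagged t.2).
have psi_ok : @td_ok _ _ (free_data p) V psi by [].
have psi_lin : linear (td_lift psi : restr (free_fun p) -> V).
  move=> c x y; rewrite td_liftD //; congr (_ + _).
  apply: td_lift_scale => //; [exact: scaler0 | exact: scalerDr |].
  by move=> [a [i f]]; rewrite /psi /= (fb_scalel hphi).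
by exists (mklin psi_lin) => a i f; rewrite mklinE -free_eltE td_lift_in.
Qed.

Lemma free_mor (Z : lMod C A) (z : forall i, Z (q i)) :
  exists h : fmor free_fun Z, forall i, h (q i) (gen i) = z i.
Proof.
have bal p : free_balanced (V := restr (Z p)) (fun a i (f : hom (q i) p) => a *: fact Z f (z i)).
  split=> [a b i f | c a i f | a i c f g].
  - exact: (@scalerDl A (Z p)).
  - by rewrite -scalerA.
  - by rewrite fact_lin scalerDr !scalerA -alg_central -scalerA.
have [h hE] := dep_choice (fun p => free_lift (bal p)).
have hlin p : linear (h p : free_fun p -> Z p).
  move=> a x y; rewrite (linearD (h p)); congr (_ + _).
  elim/free_ind: x => [|u v IHu IHv|b i f]; first by rewrite !scaler0 linear0 scaler0.
    rewrite scalerDr (linearD (h p)) IHu IHv (linearD (h p)).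
    by rewrite -(@scalerDr A (Z p)).
  by rewrite scalerA !hE scalerA.
have hnat p p' (f : hom p p') x : mklin (hlin p') (fact free_fun f x) = fact Z f (mklin (hlin p) x).
  elim/free_ind: x => [|u v IHu IHv|b i g]; first by rewrite !linear0.
    by rewrite !linearD IHu IHv.
  rewrite (linearZ_LR (fact free_fun f)) -fact_comp !mklinE !hE.
  by rewrite (linearZ_LR (fact Z f)) fact_comp.
exists (FMor hnat) => i /=.
by have := hE (q i) 1 i (idm (q i)); rewrite !fact_id !scale1r.
Qed.

Lemma free_mor_uniq (Z : lMod C A) (u v : fmor free_fun Z) :
  (forall i, u (q i) (gen i) = v (q i) (gen i)) -> forall p x, u p x = v p x.
Proof.
move=> uv p x; elim/free_ind: x => [|x y IHx IHy|a i f]; first by rewrite !linear0.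
  by rewrite !linearD IHx IHy.
by rewrite !linearZ /= !fcomp_nat uv.
Qed.

End Free.

(** * Flatness of a functor through a free cover *)

Section FlatFunctors.
Variables (k : comPzRingType) (C : klincat k) (A : kalgebra k).

Lemma eval_formal_mor (F G : lMod C A) (u : fmor F G) n (q : 'I_n -> C) p
    (z : forall i, F (q i)) (s : formal A q p) :
  u p (eval_formal z s) = eval_formal (fun i => u (q i) (z i)) s.
Proof.
rewrite /eval_formal linear_sum; apply: eq_bigr => t _.
by rewrite linearZ /= fcomp_nat.
Qed.

Lemma eval_formal_gen n (q : 'I_n -> C) p (m : free_fun A q p) :
  exists s : formal A q p, m = eval_formal (@gen _ _ A _ q) s.
Proof.
elim/free_ind: m => [|u v [s ->] [t ->]|a i f].
- by exists [::]; rewrite /eval_formal big_nil.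
- by exists (s ++ t); rewrite /eval_formal big_cat.
- exists [:: (a, existT (fun i => hom (q i) p) i f)].
  by rewrite /eval_formal big_seq1.
Qed.

Section CyclicQuotient.
Variables (F : lMod C A) (p : C) (m : F p).

(** The subfunctor generated by [m], described as what every morphism that
annihilates [m] annihilates. *)
Definition gen_mem s (x : F s) : Prop :=
  forall (Z : lMod C A) (u : fmor F Z), u p m = 0 -> u s x = 0.

Lemma gen_mem0 s : @gen_mem s 0.
Proof. by move=> Z u _; rewrite linear0. Qed.

Lemma gen_mem_lin s (a : A) x y : @gen_mem s x -> @gen_mem s y -> @gen_mem s (a *: x + y).
Proof. by move=> hx hy Z u um; rewrite linearP hx // hy // scaler0 addr0. Qed.

Lemma gen_mem_act s t (f : hom s t) x : gen_mem x -> gen_mem (fact F f x).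
Proof. by move=> hx Z u um; rewrite fcomp_nat hx // linear0. Qed.

Definition gen_sub : subfunctor F :=
  SubFunctor (sf_val := fun s => Submodule (@gen_mem0 s) (@gen_mem_lin s)) gen_mem_act.

Lemma gen_sub_mor (Z : lMod C A) (u : fmor F Z) : u p m = 0 ->
  exists v : fmor (quot_fun gen_sub) Z, forall s x, v s (quot_proj gen_sub s x) = u s x.
Proof. by move=> um; apply: quot_mor => s x; apply. Qed.

Lemma gen_sub0 : quot_proj gen_sub p m = 0.
Proof. by apply/quot_proj_eq0. Qed.

End CyclicQuotient.

Lemma fin_presented_cyclic_quotient n (q : 'I_n -> C) p (m : free_fun A q p) :
  fin_presented (quot_fun (gen_sub m)).
Proof.
have [s ms] := eval_formal_gen m.
exists n, q, 1%N, (fun _ => p), (fun _ => s),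
  (fun i => quot_proj (gen_sub m) (q i) (gen A q i)).
split=> [j | Z z zs]; first by rewrite -eval_formal_mor -ms gen_sub0.
split=> [|u v uv t y].
  have [u0 u0E] := free_mor z.
  have [|u uE] := @gen_sub_mor _ _ m Z u0.
    rewrite ms eval_formal_mor -[RHS](zs ord0); apply: eq_bigr => i _.
    by rewrite u0E.
  by exists u => i; rewrite uE u0E.
have [x <-] := quot_proj_surj y.
pose pr := quot_proj (gen_sub m).
by apply: (free_mor_uniq (u := fmor_comp u pr) (v := fmor_comp v pr)).
Qed.

(** Stated without coordinates: the value at [m] of an endomorphism only depends
on finitely many generators. *)
Lemma free_finite_support (I : Type) (q : I -> C) p (m : free_fun A q p) :
  exists n (iota : 'I_n -> I), forall psi : fmor (free_fun A q) (free_fun A q),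
    (forall i, (exists l, iota l = i) -> psi (q i) (gen A q i) = gen A q i) ->
    psi p m = m.
Proof.
elim/free_ind: m => [|u v [n1 [i1 h1]] [n2 [i2 h2]]|a i f].
- have iota0 : 'I_0 -> I by case.
  by exists 0%N, iota0 => psi _; rewrite linear0.
- exists (n1 + n2)%N, (fun l => match split l with inl x => i1 x | inr x => i2 x end).
  move=> psi hpsi; rewrite linearD h1 ?h2 // => i [l li]; apply: hpsi.
    by exists (unsplit (inr l)); rewrite unsplitK.
  by exists (unsplit (inl l)); rewrite unsplitK.
- exists 1%N, (fun _ => i) => psi hpsi.
  by rewrite linearZ /= fcomp_nat hpsi //; exists ord0.
Qed.

(** Property (V) for a morphism of functors. *)
Definition kernel_killed_fun (F X : lMod C A) (e : fmor F X) : Prop :=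
  forall p m, e p m = 0 ->
    exists2 psi : fmor F F, (forall s x, e s (psi s x) = e s x) & psi p m = 0.

(** A correction maps the kernel of [e] to itself, so the elements can be
annihilated in turn. *)
Lemma kernel_killed_family (F X : lMod C A) (e : fmor F X) n (p : 'I_n -> C)
    (m : forall j, F (p j)) :
  kernel_killed_fun e -> (forall j, e (p j) (m j) = 0) ->
  exists2 psi : fmor F F, (forall s x, e s (psi s x) = e s x) &
    forall j, psi (p j) (m j) = 0.
Proof.
move=> Ek em.
have kill_below l : exists2 psi : fmor F F, (forall s x, e s (psi s x) = e s x) &
    forall j : 'I_n, (j < l)%N -> psi (p j) (m j) = 0; last first.
  by have [psi Epsi kpsi] := kill_below n; exists psi => // j; apply: kpsi.
elim: l => [|l [psi Epsi kpsi]]; first by exists (fmor_id F).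
have [ln | nl] := ltnP l n; last first.
  by exists psi => // j _; apply: kpsi; apply: leq_trans nl.
pose jl := Ordinal ln.
have [|psi' Epsi' kpsi'] := Ek _ (psi (p jl) (m jl)); first by rewrite Epsi.
exists (fmor_comp psi' psi) => [s x | j]; first by rewrite /= Epsi' Epsi.
rewrite ltnS leq_eqVlt => /orP[/eqP jE | jl'] /=; last by rewrite kpsi ?linear0.
by have -> : j = jl by apply: val_inj.
Qed.

Section FreeCover.
Variables (I : Type) (q : I -> C) (X : lMod C A).
Local Notation F := (free_fun A q).
Variable e : fmor F X.
Hypothesis e_surj : forall p, surj (e p).

Lemma free_projective (M N : lMod C A) (d : fmor M N) (g : fmor F N) :
  (forall p, surj (d p)) -> exists h : fmor F M, forall p x, d p (h p x) = g p x.
Proof.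
move=> d_surj; have [z zE] := dep_choice (fun i => d_surj (q i) (g (q i) (gen A q i))).
have [h hE] := free_mor z; exists h => p x.
by apply: (free_mor_uniq (u := fmor_comp d h) (v := g)) => i; rewrite /= hE zE.
Qed.

(** Lift the generators of T to F. Their relations hold over X, so they take values
in the kernel of [e]; after a correction they hold in F, and F, being free, maps to
M over X. *)
Lemma killed_flat : kernel_killed_fun e -> flat_fun X.
Proof.
move=> Ek M d /epi_surj d_surj T [n [s [m [p [r [x [xr xuniv]]]]]]] g.
have [y yE] := dep_choice (fun i => e_surj (g (s i) (x i))).
have [j|psi Epsi kpsi] := kernel_killed_family (m := fun j => eval_formal y (r j)) Ek.
  rewrite eval_formal_mor -(linear0 (g (p j))) -(xr j) eval_formal_mor.
  by apply: eq_bigr => t _; rewrite yE.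
have [phi phiE] := free_projective e d_surj.
have [|[h hE] _] := xuniv M (fun i => phi (s i) (psi (s i) (y i))).
  move=> j; transitivity (fmor_comp phi psi (p j) (eval_formal y (r j))).
    by rewrite eval_formal_mor.
  by rewrite /= kpsi linear0.
exists h; have [j|_ guniq] := xuniv X (fun i => g (s i) (x i)).
  by rewrite -eval_formal_mor xr linear0.
apply: (guniq (fmor_comp d h) g) => i.
by rewrite /= hE phiE Epsi yE.
Qed.

(** The finite free functor F0 on the generators that occur in [m] is a retract of F
as far as [m] is concerned: [beta] [alpha] fixes [m]. The quotient of F0 by
[alpha] m is finitely presented and maps to X, hence lifts to [h] with values in F.
The correction is 1 - beta alpha + h alpha. *)
Lemma flat_killed : flat_fun X -> kernel_killed_fun e.
Proof.
move=> Xflat p m em; have [n [iota supp]] := free_finite_support m.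
pose F0 := free_fun A (fun l => q (iota l)).
have [beta betaE] := @free_mor _ _ A _ (fun l => q (iota l)) F (fun l => gen A q (iota l)).
have /dep_choice [a aE] : forall i, exists w : F0 (q i),
    (exists l, iota l = i) -> beta (q i) w = gen A q i.
  move=> i; have [[l <-] | no] := EM (exists l, iota l = i).
    by exists (gen A (fun l => q (iota l)) l).
  by exists 0 => /no.
have [alpha alphaE] := free_mor a.
have ba_m : beta p (alpha p m) = m.
  by apply: (supp (fmor_comp beta alpha)) => i /aE; rewrite /= alphaE.
have [|g gE] := @gen_sub_mor _ _ (alpha p m) X (fmor_comp e beta).
  by rewrite /= ba_m.
have [h hE] := Xflat _ e (surj_epi e_surj) _ (fin_presented_cyclic_quotient (alpha p m)) g.
pose pr := quot_proj (gen_sub (alpha p m)).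
have [psi psiE] := @free_mor _ _ A _ q F (fun i =>
  let x := gen A q i in x - beta (q i) (alpha (q i) x) + h (q i) (pr (q i) (alpha (q i) x))).
have {}psiE s x : psi s x = x - beta s (alpha s x) + h s (pr s (alpha s x)).
  elim/free_ind: x => [|x y IHx IHy|b i f]; first by rewrite !linear0 !addr0.
    rewrite (linearD (psi s)) (linearD (alpha s)) (linearD (beta s)) (linearD (pr s)).
    by rewrite (linearD (h s)) IHx IHy opprD [x + y + _]addrACA [RHS]addrACA.
  rewrite !linearZ_LR !fcomp_nat psiE linearD linearB.
  by rewrite !scalerDr.
exists psi => [s x|]; first by rewrite psiE linearD linearB hE gE /= subrK.
by rewrite psiE ba_m subrr add0r [pr p _]gen_sub0 linear0.
Qed.

End FreeCover.

Definition free_cover (X : lMod C A) : lMod C A := free_fun A (fun i : {p : C & X p} => tag i).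

Lemma free_cover_ex (X : lMod C A) : exists e : fmor (free_cover X) X, forall p, surj (e p).
Proof.
have [e eE] := @free_mor _ _ A _ (fun i : {p : C & X p} => tag i) X (fun i => tagged i).
exists e => p x; exists (gen A (fun i : {p : C & X p} => tag i) (existT (fun p => X p) p x)).
exact: (eE (existT (fun p => X p) p x)).
Qed.

End FlatFunctors.

(** * The tensor product over the category *)

Section TensorFunctor.
Variables (k : comPzRingType) (C : klincat k) (A : kalgebra k).

Lemma tens_ind (G : rMod C) (X : lMod C A) (Q : tens G X -> Prop) :
  Q 0 -> (forall u v, Q u -> Q v -> Q (u + v)) ->
  (forall (p : C) (g : G p) (x : X p), Q (tens_pure g x)) -> forall u, Q u.
Proof. by move=> Q0 QD Qp; apply: td_ind; [| |case=> p [g x]; apply: Qp]. Qed.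

Lemma tens_pureDl (G : rMod C) (X : lMod C A) (p : C) (g g' : G p) (x : X p) :
  tens_pure (g + g') x = tens_pure g x + tens_pure g' x.
Proof. by have := tens_pure_linl 1 g g' x; rewrite scale1r rmorph1 scale1r. Qed.

Lemma tens_pure0l (G : rMod C) (X : lMod C A) p (x : X p) :
  tens_pure (0 : G p) x = 0.
Proof. by apply: (addrI (tens_pure (0 : G p) x)); rewrite -tens_pureDl !addr0. Qed.

Lemma tens_pureZl (G : rMod C) (X : lMod C A) p (c : k) (g : G p) (x : X p) :
  tens_pure (c *: g) x = alg_map A c *: tens_pure g x.
Proof. by have := tens_pure_linl c g 0 x; rewrite tens_pure0l !addr0. Qed.

Lemma tens_pure0r (G : rMod C) (X : lMod C A) (p : C) (g : G p) :
  tens_pure g (0 : X p) = 0.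
Proof. by apply: (addrI (tens_pure g (0 : X p))); rewrite -tens_pureD !addr0. Qed.

(** Maps to A-modules; the universal property of the tensor product only
speaks of k-modules. *)
Lemma tens_lift (G : rMod C) (X : lMod C A) (N : lmodType A)
    (phi : forall p : C, G p -> X p -> N) :
  balanced (V := restr N) phi ->
  (forall (p : C) (g : G p) (a : A) (x : X p), phi p g (a *: x) = a *: phi p g x) ->
  exists h : {linear tens G X -> N},
    forall (p : C) (g : G p) (x : X p), h (tens_pure g x) = phi p g x.
Proof.
move=> bal phiZ; have [h [hD _ hE] _] := tens_adjunction bal.
have h_lin : linear (h : tens G X -> N).
  move=> a u v; rewrite hD; congr (_ + _).
  elim/tens_ind: u => [|x y IHx IHy|p g x].
  - have h0 : h 0 = 0 by apply: (addrI (h 0)); rewrite -hD !addr0.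
    by rewrite scaler0 h0 (@scaler0 A N).
  - by rewrite scalerDr !hD IHx IHy (@scalerDr A N).
  - by rewrite -tens_pureZ !hE phiZ.
by exists (mklin h_lin).
Qed.

Lemma tens_mapr_balanced (G : rMod C) (X Y : lMod C A) (e : fmor X Y) :
  balanced (V := restr (tens G Y)) (fun (p : C) (g : G p) x => tens_pure g (e p x)).
Proof.
split=> [p c g g' x | p c g x x' | p p' f g x].
- exact: tens_pure_linl.
- by rewrite linearP tens_pureD tens_pureZ.
- by rewrite tens_pure_act fcomp_nat.
Qed.

Lemma tens_mapr_scale (G : rMod C) (X Y : lMod C A) (e : fmor X Y) (p : C) (g : G p) (a : A) x :
  tens_pure g (e p (a *: x)) = a *: tens_pure g (e p x).
Proof. by rewrite linearZ tens_pureZ. Qed.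

Definition tens_mapr (G : rMod C) (X Y : lMod C A) (e : fmor X Y) :
    {linear tens G X -> tens G Y} :=
  sval (cid (tens_lift (@tens_mapr_balanced G X Y e) (@tens_mapr_scale G X Y e))).

Lemma tens_maprE (G : rMod C) (X Y : lMod C A) (e : fmor X Y) (p : C) (g : G p) x :
  tens_mapr G e (tens_pure g x) = tens_pure g (e p x).
Proof.
exact: (svalP (cid (tens_lift (@tens_mapr_balanced G X Y e) (@tens_mapr_scale G X Y e)))).
Qed.

Lemma tens_mapC (G G' : rMod C) (X Y : lMod C A) (d : fmor G G') (e : fmor X Y) z :
  tens_map Y d (tens_mapr G e z) = tens_mapr G' e (tens_map X d z).
Proof.
elim/tens_ind: z => [|u v IHu IHv|p g x]; first by rewrite !linear0.
  by rewrite !linearD IHu IHv.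
by rewrite !(tens_mapE, tens_maprE).
Qed.

Lemma tens_mapr_comp (G : rMod C) (X Y Z : lMod C A) (e : fmor X Y) (f : fmor Y Z)
    (g : fmor X Z) : (forall p x, f p (e p x) = g p x) ->
  forall z, tens_mapr G f (tens_mapr G e z) = tens_mapr G g z.
Proof.
move=> fe; elim/tens_ind=> [|u v IHu IHv|p t x]; first by rewrite !linear0.
  by rewrite !linearD IHu IHv.
by rewrite !tens_maprE fe.
Qed.

Lemma tens_mapr_id (G : rMod C) (X : lMod C A) z : tens_mapr G (fmor_id X) z = z.
Proof.
elim/tens_ind: z => [|u v IHu IHv|p g x]; first by rewrite linear0.
  by rewrite linearD IHu IHv.
by rewrite tens_maprE.
Qed.

Lemma tens_mapr_surj (G : rMod C) (X Y : lMod C A) (e : fmor X Y) :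
  (forall p, surj (e p)) -> surj (tens_mapr G e).
Proof.
move=> es; elim/tens_ind=> [|u v [x <-] [y <-]|p g y].
- by exists 0; rewrite linear0.
- by exists (x + y); rewrite linearD.
- by have [x <-] := es p y; exists (tens_pure g x); rewrite tens_maprE.
Qed.

Section Killing.
Variables (F X : lMod C A) (e : fmor F X) (G : rMod C).

(** As for modules, the quantification over [psi0] makes these elements a
submodule. *)
Definition killable_fun (z : tens G F) : Prop :=
  forall psi0 : fmor F F, (forall p y, e p (psi0 p y) = e p y) ->
  exists2 psi : fmor F F, (forall p y, e p (psi p y) = e p y) &
    tens_mapr G psi (tens_mapr G psi0 z) = 0.

Lemma killable_fun0 : killable_fun 0.
Proof. by move=> psi0 _; exists (fmor_id F) => //; rewrite !linear0. Qed.

Lemma killable_fun_lin (a : A) u v :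
  killable_fun u -> killable_fun v -> killable_fun (a *: u + v).
Proof.
move=> hu hv psi0 E0; have [psi1 E1 k1] := hu _ E0.
have [|psi2 E2 k2] := hv (fmor_comp psi1 psi0); first by move=> p y; rewrite /= E1 E0.
exists (fmor_comp psi2 psi1) => [p y|]; first by rewrite /= E2 E1.
rewrite !linearP /= -(tens_mapr_comp (f := psi2) (e := psi1)) // k1 linear0 scaler0 add0r.
rewrite -(tens_mapr_comp (f := psi2) (e := psi1)) //.
by rewrite (tens_mapr_comp (f := psi1) (e := psi0) (g := fmor_comp psi1 psi0)).
Qed.

Definition killable_fun_sub := Submodule killable_fun0 killable_fun_lin.

(** As for modules: the kernel of G (x) F -> G (x) X is spanned by the g (x) x with
x in the kernel of [e]. *)
Lemma tens_kernel_killed : (forall p, surj (e p)) -> kernel_killed_fun e ->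
  forall z, tens_mapr G e z = 0 ->
  exists2 psi : fmor F F, (forall p y, e p (psi p y) = e p y) & tens_mapr G psi z = 0.
Proof.
move=> es Ek; have [s Es] := dep_section es.
pose pi := proj killable_fun_sub.
have pure_eq (p : C) (g : G p) x x' : e p x = e p x' -> pi (tens_pure g x) = pi (tens_pure g x').
  move=> exx'; apply/proj_eq => psi0 E0.
  have [|psi E1 k1] := Ek p (psi0 p (x - x')); first by rewrite E0 linearB exx' subrr.
  exists psi => //; rewrite !linearB !tens_maprE.
  apply/eqP; rewrite subr_eq0; apply/eqP; congr tens_pure.
  by move/eqP: k1; rewrite !linearB subr_eq0 => /eqP.
have bal : balanced (V := restr (quotient killable_fun_sub))
    (fun (p : C) (g : G p) y => pi (tens_pure g (s p y))).
  split=> [p c g g' x | p c g x x' | p p' f g x].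
  - by rewrite tens_pure_linl linearP.
  - transitivity (pi (alg_map A c *: tens_pure g (s p x) + tens_pure g (s p x'))).
      by rewrite -tens_pureZ -tens_pureD; apply: pure_eq; rewrite linearP /= !Es.
    by rewrite linearP.
  - by rewrite tens_pure_act; apply: pure_eq; rewrite fcomp_nat !Es.
have [|h hE] := tens_lift bal.
  by move=> p g a x; rewrite -linearZ -tens_pureZ; apply: pure_eq; rewrite linearZ /= !Es.
have hproj z : h (tens_mapr G e z) = pi z.
  elim/tens_ind: z => [|u v IHu IHv|p g x]; first by rewrite !linear0.
    by rewrite !linearD IHu IHv.
  by rewrite tens_maprE hE; apply: pure_eq; rewrite Es.
move=> z Ez; have : pi z = 0 by rewrite -hproj Ez linear0.
move=> /proj_eq0 /(_ (fmor_id F)) [] // psi Epsi.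
by rewrite tens_mapr_id; exists psi.
Qed.

End Killing.

Section FreeTensor.
Variables (I : Type) (q : I -> C).
Local Notation F := (free_fun A q).

(** For the free functor F on generators at the q_i, P (x) F is the sum of the
P(q_i) (x)_k A. *)
Lemma tens_free_lift (P : rMod C) (N : lmodType A)
    (t : forall i, {linear P (q i) -> restr N}) :
  exists H : {linear tens P F -> N}, forall (s : C) (g : P s) (a : A) i (f : hom (q i) s),
    H (tens_pure g (a *: fact F f (gen A q i))) =
    a *: (t i (fact P (f : @hom _ (opcat C) s (q i)) g) : N).
Proof.
have Phi_ex (x : {s : C & P s}) : exists Phi : {linear restr (F (tag x)) -> restr N},
    forall (a : A) i f, Phi (a *: fact F f (gen A q i)) =
     a *: (t i (fact P (f : @hom _ (opcat C) (tag x) (q i)) (tagged x)) : N).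
  apply: free_lift; split=> [a b i f | c a i f | a i c f f'].
  - exact: (@scalerDl A N).
  - by rewrite -scalerA.
  - rewrite (@fact_lin _ _ _ _ P) linearP (@scalerDr A N); congr (_ + _).
    exact: restr_scaleC.
have [Phi PhiE] := dep_choice Phi_ex.
have bal : balanced (V := restr N)
    (fun (s : C) (g : P s) x => Phi (existT (fun s : C => P s) s g) x).
  split=> [s c g g' x | s c g x x' | s s' f g x].
  - elim/free_ind: x => [|x y IHx IHy|a i f].
    + by rewrite !linear0 addr0.
    + by rewrite !linearD IHx IHy addrACA.
    + rewrite !PhiE /= !linearP (@scalerDr A N); congr (_ + _).
      exact: restr_scaleC.
  - exact: (linearP (Phi (existT _ s g))).
  - elim/free_ind: x => [|x y IHx IHy|a i f'].
    + by rewrite !linear0.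
    + by rewrite (linearD (fact F f)) !linearD IHx IHy.
    + rewrite PhiE (linearZ_LR (fact F f)) -fact_comp PhiE /=.
      by rewrite -fact_comp.
have [|H HE] := tens_lift bal.
  move=> s g a x; elim/free_ind: x => [|x y IHx IHy|b i f].
  - by rewrite scaler0 linear0 (@scaler0 A N).
  - by rewrite scalerDr !linearD IHx IHy (@scalerDr A N).
  - by rewrite scalerA !PhiE (@scalerA A N).
by exists H => s g a i f; rewrite HE PhiE.
Qed.

End FreeTensor.
End TensorFunctor.

(** * Projective resolutions and stalks over the base ring *)

Section Resolutions.
Variables (k : comPzRingType) (C : klincat k).
Hypothesis C_proj : homs_projective C.

(** A projective functor is a retract of a free one, whose values are sums of
k-modules hom s p. *)
Lemma projective_values (G : rMod C) : projective_fun G ->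
  forall s : C, projective_module (G s).
Proof.
move=> Gproj s U V eps gam eps_surj.
pose M : rMod C := @free_cover _ (opcat C) (self_alg k) G.
have [e es] := @free_cover_ex _ (opcat C) (self_alg k) G.
have [h hE] := Gproj M G e (fmor_id G) (surj_epi es).
pose q (i : {p : opcat C & G p}) : opcat C := tag i.
have eta_ex i : exists eta : {linear @hom _ (opcat C) (q i) s -> U}, forall f,
    eps (eta f) = gam (e s (fact M f (gen (self_alg k) q i))).
  have lin : linear (fun f : @hom _ (opcat C) (q i) s =>
      gam (e s (fact M f (gen (self_alg k) q i)))).
    by move=> c f g; rewrite fact_lin !linearP.
  have [eta etaE] := @C_proj s (tag i) U V eps (mklin lin) eps_surj.
  by exists eta.
have [eta etaE] := dep_choice eta_ex.
have bal : @free_balanced _ _ (self_alg k) _ q s U (fun a i f => a *: eta i f).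
  split=> [a b i f | c a i f | a i c f g].
  - exact: scalerDl.
  - by rewrite scalerA.
  - by rewrite linearP scalerDr !scalerA mulrC.
have [H HE] := free_lift bal.
have H_lin : linear (fun x : G s => H (h s x)).
  by move=> c x y; rewrite linearP; exact: (linearP H).
exists (mklin H_lin) => x; rewrite mklinE -[in RHS](hE s x : _ = x).
elim/free_ind: (h s x) => [|u v IHu IHv|a i f]; first by rewrite !linear0.
  by rewrite (linearD H) !linearD IHu IHv.
by rewrite HE !linearZ_LR etaE.
Qed.

(** Each value is a direct summand of k, hence projective. For a stalk it is k
or 0. *)
Definition pointwise_rank1 (G : rMod C) : Prop :=
  forall s : C, exists (w : G s) (sig : {linear G s -> k^o}),
    forall x, x = (sig x : k) *: w.

(** At each object all the modules in sight are projective, so the resolution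
splits. The splittings are not natural in the object. *)
Lemma resolution_contraction (G : rMod C) (P : projective_resolution G) :
  pointwise_rank1 G -> forall s : C,
  exists (h0 : {linear res P 0 s -> res P 1 s}) (h1 : {linear res P 1 s -> res P 2 s}),
    forall x, res_d P 1 s (h1 x) + h0 (res_d P 0 s x) = x.
Proof.
move=> G1 s; have [w [sig wE]] := G1 s; have [p0 p0E] := res_aug_surj P w.
have proj_val n := projective_values (@res_proj _ _ _ P n).
have lin0 : linear (fun x => x - (sig (res_aug P s x) : k) *: p0).
  move=> c x y; rewrite !linearP /= scalerBr scalerDl scalerA.
  by rewrite opprD addrACA.
have [x|h0 h0E] := proj_lift (d := res_d P 0 s) (g := mklin lin0) (proj_val 0 s).
  by apply/res_exact0; rewrite mklinE linearB linearZ /= p0E -wE subrr.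
have lin1 : linear (fun x => x - h0 (res_d P 0 s x)).
  by move=> c x y; rewrite (linearP (res_d P 0 s)) (linearP h0) scalerBr opprD addrACA.
have dd0 x : res_aug P s (res_d P 0 s x) = 0 by apply/res_exact0; exists x.
have [x|h1 h1E] := proj_lift (d := res_d P 1 s) (g := mklin lin1) (proj_val 1 s).
  by apply/res_exact; rewrite mklinE linearB h0E mklinE dd0 linear0 scale0r subr0 subrr.
by exists h0, h1 => x; rewrite h1E mklinE subrK.
Qed.

(** P (x) F only sees P through its values at the objects of the generators, with
no naturality, so the pointwise splittings induce a contraction. *)
Lemma resolution_tens_free_exact (A : kalgebra k) (I : Type) (q : I -> C) (G : rMod C)
    (P : projective_resolution G) (z : tens (res P 1) (free_fun A q)) :
  pointwise_rank1 G -> tens_map _ (res_d P 0) z = 0 ->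
  exists v, tens_map _ (res_d P 1) v = z.
Proof.
move=> G1 dz; set F := free_fun A q.
have [h0 h0E] := dep_choice (resolution_contraction P G1).
have [h1 h01] := dep_choice h0E.
have map_ex (P' P'' : rMod C) (h : forall s : C, {linear P' s -> P'' s}) :
    exists H : {linear tens P' F -> tens P'' F},
    forall (s : C) (g : P' s) (a : A) i (f : hom (q i) s),
    H (tens_pure g (a *: fact F f (gen A q i))) =
    a *: tens_pure (h (q i) (fact P' (f : @hom _ (opcat C) s (q i)) g)) (gen A q i).
  have tlin i : linear (fun g : P' (q i) =>
      tens_pure (h (q i) g) (gen A q i) : restr (tens P'' F)).
    by move=> c g g'; rewrite linearP tens_pure_linl.
  by have [H HE] := tens_free_lift (fun i => mklin (tlin i)); exists H.
have [H0 H0E] := map_ex _ _ h0; have [H1 H1E] := map_ex _ _ h1.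
have H01 y : tens_map _ (res_d P 1) (H1 y) + H0 (tens_map _ (res_d P 0) y) = y.
  elim/tens_ind: y => [|u v IHu IHv|s g x]; first by rewrite !linear0 addr0.
    by rewrite !linearD addrACA IHu IHv.
  elim/free_ind: x => [|u v IHu IHv|a i f]; first by rewrite tens_pure0r !linear0 addr0.
    by rewrite tens_pureD !linearD addrACA IHu IHv.
  rewrite H1E linearZ_LR !tens_mapE H0E -scalerDr -fcomp_nat -tens_pureDl h01.
  by rewrite tens_pure_act tens_pureZ.
by exists (H1 z); rewrite -[RHS]H01 dz linear0 addr0.
Qed.

End Resolutions.

Section Stalks.
Variables (k : comPzRingType) (C : klincat k) (S : strong_retraction C) (q : C).

(** This covers both cases at once, without a transport along p = q: for p = q,
[om] and [et] are identities and [sig] is the coordinate along the identity; for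
p <> q, where everything is radical, all three are 0. *)
Lemma stalk_coordinate (p : C) :
  exists (sig : {linear hom p q -> k^o}) (om : hom p q) (et : hom q p),
  [/\ forall f, pseudo_radical S (f - (sig f : k) *: om),
      forall f, pseudo_radical S f -> sig f = 0,
      comp (comp om et) om = om &
      forall f, (sig f : k) *: comp om et = (sig f : k) *: idm q].
Proof.
have [<- | ne] := EM (p = q); last first.
  exists \0, 0, 0; split=> [f|//||f]; first exact: psrad_off.
    exact: (linear0 (mklin (comp_linr _))).
  by rewrite !scale0r.
have [rho rhoE] := unit_retraction S p.
have [|f c c'|a f g c c'|sig sigE] := @choose_linear k (hom p p) k^o
  (fun f c => rad S p (f - (c : k) *: idm p)).
- by move=> f; have [c [g [rg ->]]] := rad_sum S f; exists c; rewrite addrC addKr.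
- move=> rc rc'; apply/eqP; rewrite -subr_eq0 -(rhoE (c - c')).
  have /rad_direct -> : rad S p ((c - c' : k) *: idm p); last by rewrite linear0.
  have -> : (c - c' : k) *: idm p = (f - (c' : k) *: idm p) - (f - (c : k) *: idm p).
    by rewrite opprB [RHS]addrC addrA subrK scalerBl.
  by apply: subD => //; apply: subN.
- move=> rc rc'; have := sub_lin a rc rc'.
  by rewrite scalerBr addrACA -opprD scalerA -scalerDl.
exists sig, (idm p), (idm p); split=> [f|f /psrad_diagP rf||f].
- exact: psrad_diag.
- have /rad_direct sf : rad S p ((sig f : k) *: idm p).
    by rewrite -[_ *: _](subKr f); apply: subD => //; apply: subN.
  by rewrite -(rhoE (sig f)) sf linear0.
- by rewrite !comp1m.
- by rewrite comp1m.
Qed.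

End Stalks.

(** * From flatness to the homological conditions *)

Section Forward.
Variables (k : comPzRingType) (C : klincat k) (A : kalgebra k).
Variables (S : strong_retraction C) (q : C).

Definition germ (p : C) : {linear hom p q -> stalk S q p} :=
  proj (pseudo_radical_sub S p q).

Lemma germ_surj p : surj (germ p).
Proof. exact: proj_surj. Qed.

Lemma germ_eq0 p f : germ p f = 0 <-> pseudo_radical S f.
Proof. exact: proj_eq0. Qed.

Lemma germ_act (p s : C) (f : hom p s) (g : hom s q) :
  fact (stalk S q) (f : @hom _ (opcat C) s p) (germ s g) = germ p (comp g f).
Proof. exact: stalk_actE. Qed.

Lemma stalk_pointwise_rank1 : pointwise_rank1 (stalk S q).
Proof.
move=> p; have [sig [om [et [sigE sig0 _ _]]]] := stalk_coordinate S q p.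
have [sig' sig'E] := quot_lift (N := pseudo_radical_sub S p q) sig0.
exists (germ p om), sig' => x; have [f <-] := germ_surj x.
rewrite sig'E -linearZ; apply/eqP; rewrite -subr_eq0 -linearB; apply/eqP.
exact/germ_eq0.
Qed.

Section Free.
Variables (I : Type) (d : I -> C).
Local Notation F := (free_fun A d).

(** C_q(F) is the sum of the S{q}(q_i) (x)_k A, so it is spanned by the w_i (x) u_i
for u_i the generators of F and w_i spanning the stalk at q_i; the coordinate
along the j-th one comes from [tens_free_lift]. *)
Lemma C_functor_locally_projective : locally_projective (C_functor S q F).
Proof.
have [w wE] := dep_choice stalk_pointwise_rank1.
have [sig sigE] := dep_choice wE.
pose b i : C_functor S q F := tens_pure (w (d i)) (gen A d i).
pose coord (j i : I) (g : stalk S q (d i)) : restr (A^o : lmodType A) :=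
  if `[< i = j >] then alg_map A (sig (d i) g) else 0.
have coord_lin (j i : I) : linear (coord j i).
  move=> c g g'; rewrite /coord; case: `[< i = j >]; last by rewrite scaler0 addr0.
  by rewrite linearP rmorphD rmorphM.
have [c cE] := choice (fun j => tens_free_lift (fun i => mklin (coord_lin j i))).
pose expands (s : seq {classic I}) x := forall L : seq {classic I},
  uniq L -> {subset s <= L} -> x = \sum_(i <- L) (c i x : A) *: b i.
have expands0 : expands [::] 0.
  by move=> L _ _; rewrite big1 // => i _; rewrite linear0 scale0r.
have expandsD s1 s2 x y : expands s1 x -> expands s2 y -> expands (s1 ++ s2) (x + y).
  move=> h1 h2 L uL sL.
  transitivity (\sum_(i <- L) (c i x : A) *: b i + \sum_(i <- L) (c i y : A) *: b i).
    congr (_ + _); [apply: h1 | apply: h2] => // i si.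
      by apply: sL; rewrite mem_cat si.
    by apply: sL; rewrite mem_cat si orbT.
  by rewrite -big_split; apply: eq_bigr => i _; rewrite linearD scalerDl.
have expandsG p (g : stalk S q p) (a : A) i (f : hom (d i) p) :
    expands [:: i : {classic I}] (tens_pure g (a *: fact F f (gen A d i))).
  move=> L uL sL.
  rewrite (bigD1_seq (i : {classic I})) ?sL ?mem_head //= big1 ?addr0.
    rewrite cE mklinE /coord asboolT // tens_pureZ -tens_pure_act.
    by rewrite {1}(sigE (d i) (fact _ _ g)) tens_pureZl scalerA.
  move=> j ji; rewrite cE mklinE /coord asboolF.
    by rewrite (@scaler0 A A^o) scale0r.
  by move=> ij; rewrite ij eqxx in ji.
have expand x : exists s, expands s x.
  elim/tens_ind: x => [|x y [s1 h1] [s2 h2]|p g x].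
  - by exists [::]; apply: expands0.
  - by exists (s1 ++ s2); apply: expandsD.
  elim/free_ind: x => [|x y [s1 h1] [s2 h2]|a i f].
  - by exists [::]; rewrite tens_pure0r; apply: expands0.
  - by exists (s1 ++ s2); rewrite tens_pureD; apply: expandsD.
  - by exists [:: i : {classic I}]; apply: expandsG.
move=> ns; have [s hs] : exists s, forall x, x \in ns -> expands s x.
  elim: ns => [|x ns [s hs]]; first by exists [::].
  have [s' hs'] := expand x; exists (s' ++ s) => y; rewrite inE => /orP[/eqP-> | yns] L uL sL.
    by apply: hs' => // i si; apply: sL; rewrite mem_cat si.
  by apply: hs => // i si; apply: sL; rewrite mem_cat si orbT.
pose L := in_tuple (undup s).
exists (size (undup s)), (fun l => b (tnth L l)), (fun l => c (tnth L l)) => x /hs hx.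
have {1}-> := hx _ (undup_uniq s); first by rewrite big_tnth.
by move=> i; rewrite mem_undup.
Qed.

Variables (X : lMod C A) (e : fmor F X).
Hypothesis e_surj : forall p, surj (e p).
Hypothesis e_killed : kernel_killed_fun e.

Lemma killed_C_functor_flat : flat_module (C_functor S q X).
Proof.
apply: (kernel_killed_flat (E := tens_mapr (stalk S q) e)).
- exact: tens_mapr_surj.
- exact: C_functor_locally_projective.
- move=> z /(tens_kernel_killed e_surj e_killed) [psi epsi psiz].
  exists (tens_mapr (stalk S q) psi) => // y.
  by rewrite (tens_mapr_comp (g := e)).
Qed.

Lemma killed_H1_vanishes : homs_projective C -> H1_vanishes S q X.
Proof.
move=> C_proj P; elim/pq_ind=> -[z dz]; apply/pqP => /=; rewrite subr0.
have [w wz] := tens_mapr_surj (G := res P 1) e_surj z.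
have [|psi epsi psiw] := tens_kernel_killed e_surj e_killed (z := tens_map F (res_d P 0) w).
  by rewrite -tens_mapC wz.
have [|v vE] := resolution_tens_free_exact C_proj (P := P) (z := tens_mapr (res P 1) psi w)
  stalk_pointwise_rank1.
  by rewrite tens_mapC.
exists (tens_mapr (res P 2) e v); rewrite tens_mapC vE (tens_mapr_comp (g := e)) //.
Qed.

End Free.
End Forward.

(** * Radical multiples, stalk classes and a resolution of the stalk *)

Section Multiples.
Variables (k : comPzRingType) (C : klincat k) (A : kalgebra k).

Definition act_fun (X : lMod C A) p s (x : X p) (f : hom p s) : restr (X s) := fact X f x.

Lemma act_linear (X : lMod C A) p s (x : X p) : linear (@act_fun X p s x).
Proof. by move=> c f g; apply: fact_lin. Qed.

Definition act (X : lMod C A) p s (x : X p) : {linear hom p s -> restr (X s)} :=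
  mklin (@act_linear X p s x).

Lemma factB (X : lMod C A) p s (f g : hom p s) (x : X p) :
  fact X (f - g) x = fact X f x - fact X g x.
Proof. exact: (linearB (act s x)). Qed.

Lemma fact0l (X : lMod C A) p s (x : X p) : fact X (0 : hom p s) x = 0.
Proof. exact: (linear0 (act s x)). Qed.

Lemma factZl (X : lMod C A) p s c (f : hom p s) (x : X p) :
  fact X (c *: f) x = alg_map A c *: fact X f x.
Proof. exact: (linearZ_LR (act s x)). Qed.

Section Span.
Variables (J : cat_ideal C) (X : lMod C A) (N : subfunctor X).

Inductive ideal_span p : X p -> Prop :=
| ideal_span0 : ideal_span 0
| ideal_spanD x y : ideal_span x -> ideal_span y -> ideal_span (x + y)
| ideal_span_act s (f : hom s p) x : J f -> N s x -> ideal_span (fact X f x).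

Lemma ideal_span_lin p (a : A) (x y : X p) :
  ideal_span x -> ideal_span y -> ideal_span (a *: x + y).
Proof.
move=> hx hy; apply: ideal_spanD => //.
elim: hx => [|u v _ hu _ hv|s f u Jf Nu].
- by rewrite scaler0; apply: ideal_span0.
- by rewrite scalerDr; apply: ideal_spanD.
- by rewrite -linearZ_LR; apply: ideal_span_act => //; apply: subZ.
Qed.

Definition ideal_span_sub p := Submodule (@ideal_span0 p) (@ideal_span_lin p).

End Span.

(** With it, [ideal_span J (full_sub X)] is the subfunctor J X. *)
Definition full_sub (X : lMod C A) : subfunctor X :=
  SubFunctor (sf_val := fun p => @Submodule A (X p) (fun _ => True) I (fun _ _ _ _ _ => I))
    (fun _ _ _ _ _ => I).

Lemma ker_fun_act (F X : lMod C A) (e : fmor F X) p s (f : hom p s) x :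
  ker_sub (e p) x -> ker_sub (e s) (fact F f x).
Proof. by move=> /= ex; rewrite fcomp_nat ex linear0. Qed.

Definition ker_fun (F X : lMod C A) (e : fmor F X) : subfunctor F :=
  SubFunctor (sf_val := fun p => ker_sub (e p)) (@ker_fun_act F X e).

Lemma ideal_span_lift (J : cat_ideal C) (F X : lMod C A) (e : fmor F X) p x :
  (forall p, surj (e p)) -> ideal_span J (full_sub X) (p := p) x ->
  exists2 y, ideal_span J (full_sub F) y & e p y = x.
Proof.
move=> es; elim=> [|_ _ _ [x1 h1 <-] _ [y1 h2 <-]|s f u Jf _].
- by exists 0; [exact: ideal_span0 | exact: linear0].
- by exists (x1 + y1); [exact: ideal_spanD | exact: linearD].
- have [v <-] := es s u; exists (fact F f v); last exact: fcomp_nat.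
  exact: ideal_span_act.
Qed.

End Multiples.

Section StalkTensor.
Variables (k : comPzRingType) (C : klincat k) (A : kalgebra k).
Variables (S : strong_retraction C) (q : C).

(** The projection of X(q) onto C_q(X) = X(q) / (r X)(q): see [stalk_class_surj],
[stalk_class_eq0] and [stalk_class_span]. *)
Definition stalk_class_fun (X : lMod C A) (x : X q) : C_functor S q X :=
  tens_pure (germ S q q (idm q)) x.

Lemma stalk_class_linear (X : lMod C A) : linear (@stalk_class_fun X).
Proof. by move=> a x y; rewrite /stalk_class_fun tens_pureD tens_pureZ. Qed.

Definition stalk_class (X : lMod C A) : {linear X q -> C_functor S q X} :=
  mklin (@stalk_class_linear X).

Lemma stalk_class_act (X : lMod C A) (p : C) (f : hom p q) (x : X p) :
  stalk_class X (fact X f x) = tens_pure (germ S q p f) x.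
Proof. by rewrite mklinE /stalk_class_fun -tens_pure_act germ_act comp1m. Qed.

Lemma stalk_class_surj (X : lMod C A) : surj (stalk_class X).
Proof.
elim/tens_ind=> [|_ _ [x <-] [y <-]|p g x].
- by exists 0; rewrite linear0.
- by exists (x + y); rewrite linearD.
- by have [f <-] := germ_surj g; exists (fact X f x); rewrite stalk_class_act.
Qed.

Lemma stalk_class_mapr (X Y : lMod C A) (e : fmor X Y) x :
  tens_mapr (stalk S q) e (stalk_class X x) = stalk_class Y (e q x).
Proof. exact: tens_maprE. Qed.

(** The inverse C_q(X) -> X(q) / (r X)(q) maps g (x) y to the class of f y, for any f
with germ g. *)
Lemma stalk_class_eq0 (X : lMod C A) x : stalk_class X x = 0 ->
  ideal_span (pseudo_radical S) (full_sub X) x.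
Proof.
pose N := ideal_span_sub (pseudo_radical S) (full_sub X) q; pose pi := proj N.
have [rep repE] := dep_section (fun p => @germ_surj _ _ S q p).
have pi_germ p (f g : hom p q) (y : X p) : germ S q p f = germ S q p g ->
    pi (fact X f y) = pi (fact X g y).
  move=> fg; apply/proj_eq; rewrite -factB; apply: ideal_span_act => //.
  by apply/germ_eq0; rewrite linearB fg subrr.
have bal : balanced (V := restr (quotient N))
    (fun (p : C) (g : stalk S q p) y => pi (fact X (rep p g) y)).
  split=> [p c g g' y | p c g y y' | p s f g y].
  - transitivity (pi (fact X (c *: rep p g + rep p g') y)).
      by apply: pi_germ; rewrite linearP !repE.
    by rewrite fact_lin linearP.
  - by rewrite linearP linearP.
  - by rewrite -fact_comp; apply: pi_germ; rewrite -germ_act !repE.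
have [|h hE] := tens_lift bal; first by move=> p g a y; rewrite !linearZ_LR.
move=> x0; apply/(proj_eq0 N); rewrite -[RHS](linear0 h) -x0 hE.
by rewrite -{1}[x]fact_id; apply: pi_germ; rewrite repE.
Qed.

Lemma stalk_class_span (X : lMod C A) x :
  ideal_span (pseudo_radical S) (full_sub X) x -> stalk_class X x = 0.
Proof.
elim=> {x}[|u v _ hu _ hv|s f u Jf _]; first exact: linear0.
  by rewrite linearD hu hv addr0.
by have /germ_eq0 f0 := Jf; rewrite stalk_class_act f0 tens_pure0l.
Qed.

End StalkTensor.

Section RepresentableResolution.
Variables (k : comPzRingType) (C : klincat k).

(** The free functor on all elements of the kernel. *)
Lemma kernel_cover (G H : rMod C) (d : fmor G H) :
  exists (P : rMod C) (e : fmor P G), projective_fun P /\ forall p : C, exact_at (e p) (d p).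
Proof.
pose q (i : {p : opcat C & {x : G p | d p x = 0}}) : opcat C := tag i.
have [e eE] := @free_mor _ (opcat C) (self_alg k) _ q G (fun i => sval (tagged i)).
exists (@free_fun _ (opcat C) (self_alg k) _ q), e; split=> [M N b g /epi_surj bs | p y].
  exact: (@free_projective _ (opcat C) (self_alg k) _ q M N b g bs).
split=> [dy | [x <-]].
  exists (gen (self_alg k) q (existT (fun p => {x : G p | d p x = 0}) p (exist _ y dy))).
  exact: (eE (existT (fun p => {x : G p | d p x = 0}) p (exist _ y dy))).
elim/free_ind: x => [|u v hu hv|a [s [x dx]] f]; first by rewrite !linear0.
  by rewrite !linearD hu hv addr0.
by rewrite !linearZ_LR !fcomp_nat eE /= dx linear0 scaler0.
Qed.

(** A step of a resolution, with the functor that it resolves next to the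
projective one, so that consecutive steps match by computation. *)
Record stage := Stage {
  stage_src : rMod C;
  stage_tgt : rMod C;
  stage_map : fmor stage_src stage_tgt;
  stage_proj : projective_fun stage_src
}.

Definition next_src (t : stage) : rMod C := sval (cid (kernel_cover (stage_map t))).
Definition next_map (t : stage) : fmor (next_src t) (stage_src t) :=
  sval (cid (svalP (cid (kernel_cover (stage_map t))))).

Lemma next_proj t : projective_fun (next_src t).
Proof. by have [] := svalP (cid (svalP (cid (kernel_cover (stage_map t))))). Qed.

Lemma next_exact t (p : C) : exact_at (next_map t p) (stage_map t p).
Proof. by have [_] := svalP (cid (svalP (cid (kernel_cover (stage_map t))))). Qed.

Definition next_stage (t : stage) : stage := Stage (next_map t) (@next_proj t).

Section From.
Variables (P0 G : rMod C) (aug : fmor P0 G).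
Hypotheses (P0_proj : projective_fun P0) (aug_surj : forall p : C, surj (aug p)).

Definition stages n : stage := iter n next_stage (Stage aug P0_proj).

Definition resolution_from : projective_resolution G :=
  @ProjectiveResolution _ C G (fun n => stage_src (stages n))
    (fun n => @stage_proj (stages n)) (fun n => stage_map (stages n.+1)) aug aug_surj
    (@next_exact (stages 0)) (fun n => @next_exact (stages n.+1)).

End From.

Variable q : C.

Definition rep_act (p s : C) (f : hom p s) : {linear hom s q -> hom p q} :=
  mklin (@comp_linl _ C p s q f).

Lemma rep_act_lin (s p : C) (a : k) (f g : @hom _ (opcat C) s p) (x : hom s q) :
  rep_act (a *: f + g : hom p s) x = a *: rep_act f x + rep_act g x.
Proof. exact: (comp_linr x). Qed.

Lemma rep_act_id (p : C) (x : hom p q) : rep_act (idm p) x = x.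
Proof. exact: compm1. Qed.

Lemma rep_act_comp (p r s : opcat C) (g : hom r s) (f : hom p r) (x : @hom _ C p q) :
  rep_act (comp g f) x = rep_act g (rep_act f x).
Proof. exact: compA. Qed.

Definition representable : rMod C :=
  @KLFun k (opcat C) k (@idfun k) (fun p => @hom _ C p q)
    (fun s p f => rep_act f) rep_act_lin rep_act_id rep_act_comp.

Lemma representable_projective : projective_fun representable.
Proof.
move=> M N e g /epi_surj es; have [m mE] := es q (g q (idm q : @hom _ C q q)).
have h_lin p : linear (fun f : @hom _ C p q => fact M (f : @hom _ (opcat C) q p) m).
  by move=> c f f'; rewrite fact_lin.
have h_nat (s p : opcat C) (f : hom s p) x :
    mklin (h_lin p) (fact representable f x) = fact M f (mklin (h_lin s) x).
  exact: fact_comp.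
exists (@FMor _ _ _ _ representable M (fun p => mklin (h_lin p)) h_nat) => p x.
by rewrite /= fcomp_nat mE -fcomp_nat /= comp1m.
Qed.

End RepresentableResolution.

(** * From the homological conditions to flatness *)

Section Backward.
Variables (k : comPzRingType) (C : klincat k) (A : kalgebra k).
Variables (S : strong_retraction C).
Local Notation r := (pseudo_radical S).

Lemma eval_rep_ex q (Y : lMod C A) :
  exists ev : {linear tens (representable q) Y -> Y q},
    forall (p : C) (f : hom p q) (y : Y p),
    ev (tens_pure (f : representable q p) y) = fact Y f y.
Proof.
have bal : balanced (V := restr (Y q))
    (fun (p : C) (f : representable q p) (y : Y p) => fact Y (f : hom p q) y).
  split=> [p c f f' y | p c f y y' | p s f g y].
  - exact: fact_lin.
  - exact: linearP.
  - by rewrite /= fact_comp.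
by have [|ev evE] := tens_lift bal; [move=> p f a y; rewrite linearZ_LR | exists ev].
Qed.

Definition eval_rep q (Y : lMod C A) : {linear tens (representable q) Y -> Y q} :=
  sval (cid (eval_rep_ex q Y)).

Lemma eval_repE q (Y : lMod C A) (p : C) (f : hom p q) (y : Y p) :
  eval_rep q Y (tens_pure (f : representable q p) y) = fact Y f y.
Proof. exact: (svalP (cid (eval_rep_ex q Y))). Qed.

(** Since f (x) y = 1 (x) f y, an element is the class 1 (x) y of its value y. *)
Lemma eval_rep_inj q (Y : lMod C A) z : eval_rep q Y z = 0 -> z = 0.
Proof.
have zE : z = tens_pure (idm q : representable q q) (eval_rep q Y z).
  elim/tens_ind: z => [|u v hu hv|p f y]; first by rewrite linear0 tens_pure0r.
    by rewrite linearD tens_pureD -hu -hv.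
  by rewrite eval_repE -tens_pure_act /= comp1m.
by move=> z0; rewrite zE z0 tens_pure0r.
Qed.

Lemma eval_rep_nat q (Y Z : lMod C A) (e : fmor Y Z) z :
  eval_rep q Z (tens_mapr (representable q) e z) = e q (eval_rep q Y z).
Proof.
elim/tens_ind: z => [|u v hu hv|p f y]; first by rewrite !linear0.
  by rewrite !linearD hu hv.
by rewrite tens_maprE !eval_repE fcomp_nat.
Qed.

Lemma germ_nat q (p s : opcat C) (f : hom p s) (g : representable q p) :
  germ S q s (fact (representable q) f g) = fact (stalk S q) f (germ S q p g).
Proof. by rewrite germ_act. Qed.

Definition augmentation q : fmor (representable q) (stalk S q) :=
  @FMor _ _ _ _ (representable q) (stalk S q) (fun p => germ S q p) (@germ_nat q).

Section Cover.
Variables (F X : lMod C A) (e : fmor F X).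
Hypothesis e_surj : forall p, surj (e p).

(** Sending b (x) x to the class of d(b) y, for any lift y of x to F, gives a map
P1 (x) X -> F(q) / (r K)(q). It is well defined: two lifts differ by an element of K,
and d(b) is radical. *)
Lemma radical_image_kernel q (P1 : rMod C) (d : fmor P1 (representable q)) z :
  (forall (p : C) b, r (d p b : hom p q)) ->
  tens_mapr P1 e z = 0 ->
  ideal_span r (ker_fun e) (eval_rep q F (tens_map F d z)).
Proof.
move=> dr; pose N := ideal_span_sub r (ker_fun e) q; pose pi := proj N.
have [s sE] := dep_section e_surj.
have pi_lift (p : C) b (x y : F p) : e p x = e p y ->
    pi (fact F (d p b : hom p q) x) = pi (fact F (d p b : hom p q) y).
  move=> exy; apply/proj_eq; rewrite -linearB; apply: ideal_span_act; first exact: dr.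
  by rewrite /= linearB exy subrr.
have bal : balanced (V := restr (quotient N))
    (fun (p : C) (b : P1 p) x => pi (fact F (d p b : hom p q) (s p x))).
  split=> [p c b b' x | p c b x x' | p p' f b x].
  - by rewrite linearP fact_lin linearP.
  - transitivity (pi (fact F (d p b : hom p q) (alg_map A c *: s p x + s p x'))).
      by apply: pi_lift; rewrite linearP !sE.
    by rewrite !linearP.
  - by rewrite fcomp_nat /= fact_comp; apply: pi_lift; rewrite fcomp_nat !sE.
have [|h hE] := tens_lift bal.
  move=> p b a x; rewrite -!linearZ_LR; apply: pi_lift.
  by rewrite linearZ_LR !sE.
have hpi w : h (tens_mapr P1 e w) = pi (eval_rep q F (tens_map F d w)).
  elim/tens_ind: w => [|u v hu hv|p b x]; first by rewrite !linear0.
    by rewrite !linearD hu hv.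
  by rewrite tens_maprE hE tens_mapE eval_repE; apply: pi_lift; rewrite sE.
by move=> ez; apply/(proj_eq0 N); rewrite -hpi ez linear0.
Qed.

(** Use a resolution of the stalk that starts with C(-, q). An element m of (r F)(q)
is the boundary of a chain w of P_1 (x) F. When m lies in K, the image of w in
P_1 (x) X is a cycle, hence the boundary of a chain, which lifts to y in P_2 (x) F.
Then w - d y has the same boundary m and vanishes in P_1 (x) X. *)
Lemma H1_kernel_radical q : H1_vanishes S q X ->
  forall m : F q, e q m = 0 -> ideal_span r (full_sub F) m ->
  ideal_span r (ker_fun e) m.
Proof.
move=> H1 m em m_rF.
pose P := resolution_from (@representable_projective _ C q)
  (fun p => @germ_surj _ _ S q p : surj (augmentation q p)).
have rd (p : C) b : r (res_d P 0 p b : hom p q).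
  by apply/germ_eq0; apply: (proj2 (@res_exact0 _ _ _ P p (res_d P 0 p b))); exists b.
have [w wm] : exists w, eval_rep q F (tens_map F (res_d P 0) w) = m.
  elim: m_rF {em} => [|_ _ _ [u <-] _ [v <-]|s f x rf _].
  - by exists 0; rewrite !linear0.
  - by exists (u + v); rewrite !linearD.
  - have [b bf] := proj1 (@res_exact0 _ _ _ P s (f : hom s q)) (proj2 (germ_eq0 S f) rf).
    by exists (tens_pure b x); rewrite tens_mapE bf eval_repE.
have dw : tens_map X (res_d P 0) (tens_mapr (res P 1) e w) = 0.
  by apply: (@eval_rep_inj q X); rewrite tens_mapC eval_rep_nat wm.
have /pqP /= [v] := H1 P (pq (P := homology_pre _ _) (exist _ _ dw)).
rewrite subr0 => vE; have [y yv] := tens_mapr_surj (G := res P 2) e_surj v.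
have : ideal_span r (ker_fun e)
    (eval_rep q F (tens_map F (res_d P 0) (w - tens_map F (res_d P 1) y))).
  by apply: radical_image_kernel => //; rewrite linearB -tens_mapC yv vE subrr.
rewrite linearB linearB wm.
have -> : tens_map F (res_d P 0) (tens_map F (res_d P 1) y) = 0.
  elim/tens_ind: y {yv} => [|u v' hu hv|p b x]; first by rewrite !linear0.
    by rewrite !linearD hu hv addr0.
  rewrite !tens_mapE; have -> : res_d P 0 p (res_d P 1 p b) = 0; last exact: tens_pure0l.
  by apply/(@res_exact _ _ _ P 0 p); exists b.
by rewrite linear0 subr0.
Qed.

End Cover.

Section Free.
Variables (I : Type) (d : I -> C) (X : lMod C A).
Local Notation F := (free_fun A d).
Variable e : fmor F X.
Hypothesis e_surj : forall p, surj (e p).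

(** Flatness gives an endomorphism [psib] of C_q(F) over C_q(X) that annihilates the
class of m. The correction [psi] inducing it moves the generators u_i at q
to elements [y i] that represent the images of their classes, and leaves the other
generators alone. *)
Lemma flat_stalk_kills q : flat_module (C_functor S q X) -> forall m : F q, e q m = 0 ->
  exists2 psi : fmor F F, (forall p x, e p (psi p x) = e p x) &
    ideal_span r (full_sub F) (psi q m).
Proof.
move=> Xflat m em; pose E := tens_mapr (stalk S q) e.
have [|||psib Epsib psib_m] := flat_kernel_killed (E := E) _ _ Xflat (x := stalk_class S q F m).
- exact: tens_mapr_surj.
- exact: C_functor_locally_projective.
- by rewrite stalk_class_mapr em linear0.
have [sig sigP] := dep_choice (stalk_coordinate S q).
have [om omP] := dep_choice sigP; have [et etP] := dep_choice omP.
(* A representative of the prescribed class is only over the right element of X(q)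
   up to (r X)(q); the difference lifts to (r F)(q), where it can be subtracted. *)
have y_ex i : exists y : F q, e q y = fact X (om (d i)) (e (d i) (gen A d i)) /\
    stalk_class S q F y = psib (tens_pure (germ S q (d i) (om (d i))) (gen A d i)).
  have [y0 y0E] := stalk_class_surj (psib (tens_pure (germ S q (d i) (om (d i))) (gen A d i))).
  have [|rho rho_r rhoE] := @ideal_span_lift _ _ _ r F X e q
      (e q y0 - fact X (om (d i)) (e (d i) (gen A d i))) e_surj.
    apply: stalk_class_eq0; rewrite linearB stalk_class_act -stalk_class_mapr y0E Epsib.
    by rewrite /E tens_maprE subrr.
  exists (y0 - rho); split; first by rewrite linearB rhoE opprB addrC subrK.
  by rewrite linearB y0E stalk_class_span ?subr0.
have [y yP] := choice y_ex.
(* et om is the identity at q and 0 at the other objects *)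
have [psi psiE] := @free_mor _ _ A _ d F (fun i => let x := gen A d i in
  x - fact F (comp (et (d i)) (om (d i))) x + fact F (et (d i)) (y i)).
have psi_class n : stalk_class S q F (psi q n) = psib (stalk_class S q F n).
  elim/free_ind: n => [|u v hu hv|a i f]; first by rewrite !linear0.
    by rewrite !linearD hu hv.
  have [f_om _ om_et sig_et] := etP (d i); have [_ yE] := yP i.
  have germ_f : germ S q (d i) f = (sig (d i) f : k) *: germ S q (d i) (om (d i)).
    rewrite -linearZ; apply/eqP; rewrite -subr_eq0 -linearB; apply/eqP.
    exact/germ_eq0.
  rewrite !linearZ_LR fcomp_nat !stalk_class_act germ_f !tens_pureZl linearZ_LR -yE.
  congr (_ *: _); rewrite -stalk_class_act psiE linearD linearB -!fact_comp compA om_et subrr add0r.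
  rewrite -(linearZ_LR (stalk_class S q F)) -[RHS](linearZ_LR (stalk_class S q F)).
  congr (stalk_class S q F _).
  by rewrite -!factZl sig_et factZl fact_id.
exists psi => [p x|]; last by apply: stalk_class_eq0; rewrite psi_class.
apply: (free_mor_uniq (u := fmor_comp e psi) (v := e)) => i.
have [ey _] := yP i.
by rewrite /= psiE linearD linearB !fcomp_nat ey fact_comp subrK.
Qed.

Hypotheses (H1_all : forall q, H1_vanishes S q X)
  (C_flat : forall q, flat_module (C_functor S q X)).

(** One correction moves m to a sum of f x with f in r and x in K, and by induction
a further one moves each x into r^n K. As in [killable], the terms of
the sum are treated in turn by asking for the second correction after an arbitrary
one. *)
Lemma kernel_into_radical_power n p (m : F p) : e p m = 0 ->
  exists2 psi : fmor F F, (forall s x, e s (psi s x) = e s x) &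
    ideal_span (ideal_exp r n.+1) (ker_fun e) (psi p m).
Proof.
elim: n p m => [|n IHn] p m em.
  have [psi epsi psim] := flat_stalk_kills (@C_flat p) em.
  exists psi => //; apply: H1_kernel_radical => //.
  by rewrite epsi.
have [psi epsi psim] := flat_stalk_kills (@C_flat p) em.
have {}psim : ideal_span r (ker_fun e) (psi p m).
  by apply: H1_kernel_radical => //; rewrite epsi.
have span_psi (J : cat_ideal C) (phi : fmor F F) : (forall s x, e s (phi s x) = e s x) ->
    forall s (x : F s), ideal_span J (ker_fun e) x -> ideal_span J (ker_fun e) (phi s x).
  move=> ephi s x; elim=> [|u v _ hu _ hv|t f u Jf eu].
  - by rewrite linear0; apply: ideal_span0.
  - by rewrite linearD; apply: ideal_spanD.
  - by rewrite fcomp_nat; apply: ideal_span_act => //=; rewrite ephi.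
have {psim} [psi' epsi' h] : exists2 psi' : fmor F F, (forall s x, e s (psi' s x) = e s x) &
    ideal_span (ideal_exp r n.+2) (ker_fun e) (psi' p (psi p m)).
  have : forall psi0 : fmor F F, (forall s x, e s (psi0 s x) = e s x) ->
    exists2 psi' : fmor F F, (forall s x, e s (psi' s x) = e s x) &
    ideal_span (ideal_exp r n.+2) (ker_fun e) (psi' p (psi0 p (psi p m))); last first.
    by move=> h; apply: (h (fmor_id F)).
  elim: psim => [|u v _ hu _ hv|s f x rf ex] psi0 epsi0.
  - by exists (fmor_id F) => //; rewrite !linear0; apply: ideal_span0.
  - have [psi1 epsi1 h1] := hu _ epsi0.
    have [|psi2 epsi2 h2] := hv (fmor_comp psi1 psi0).
      by move=> s x; rewrite /= epsi1 epsi0.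
    exists (fmor_comp psi2 psi1) => [s x|]; first by rewrite /= epsi2 epsi1.
    rewrite !linearD; apply: ideal_spanD; last exact: h2.
    exact: (span_psi _ psi2 epsi2 _ _ h1).
  - have [|psi1 epsi1 h1] := IHn _ (psi0 s x); first by rewrite epsi0.
    exists psi1 => //; rewrite !fcomp_nat.
    elim: h1 => [|u v _ hu _ hv|t g u Jg eu].
    + by rewrite linear0; apply: ideal_span0.
    + by rewrite linearD; apply: ideal_spanD.
    + by rewrite -fact_comp; apply: ideal_span_act => //; apply: ideal_mul_comp.
by exists (fmor_comp psi' psi) => // s x; rewrite /= epsi' epsi.
Qed.

Lemma nilpotent_kernel_killed : nilpotent_ideal r -> kernel_killed_fun e.
Proof.
move=> [N rN] p m em.
(* The 0-th power of an ideal consists of all morphisms, so r^0 = 0 forces r = 0 and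
   the exponent N.-1.+1 is good for N = 0 as well. *)
have [psi epsi h] := kernel_into_radical_power N.-1 em.
exists psi => //; elim: h => [//|u v _ -> _ ->|s f x Jf _]; first by rewrite addr0.
suff -> : f = 0 by apply: fact0l.
by case: N rN Jf => [|N] rN Jf; apply: rN.
Qed.

End Free.
End Backward.

Theorem theorem2p5 (k : comPzRingType) (A : kalgebra k) (C : klincat k)
    (C_proj : homs_projective C)
    (C_fin : Hom_finite C)
    (S : strong_retraction C)
    (r_nil : nilpotent_ideal (pseudo_radical S))
    (X : lMod C A) :
  flat_fun X <->
  forall q : C, H1_vanishes S q X /\ flat_module (C_functor S q X).
Proof.
have [e e_surj] := free_cover_ex X; split=> [Xflat q | hX].
  have e_killed := flat_killed e_surj Xflat.
  split; first exact: (killed_H1_vanishes e_surj e_killed).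
  exact: (@killed_C_functor_flat _ _ _ S q _ _ _ e).
apply: (killed_flat e_surj); apply: nilpotent_kernel_killed r_nil => // q.
  by have [] := hX q.
by have [] := hX q.
Qed.
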